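(* Let $E \subset \mathbb{C}$ be compact and let $h:\mathbb{D} \times \widehat{\mathbb{C}} \to \widehat{\mathbb{C}}$ be a holomorphic motion of $\widehat{\mathbb{C}}$ with $h(\lambda,\infty)=\infty$ for all $\lambda \in \mathbb{D}$. For $\lambda\in\mathbb{D}$ write $E_\lambda:=\{h(\lambda,z): z\in E\}$. Then the function $$\lambda \mapsto c(E_\lambda) \qquad (\lambda \in \mathbb{D})$$ is continuous on $\mathbb{D}$, where $c$ denotes logarithmic capacity.
   Context: $\mathbb{D}$ is the open unit disk in $\mathbb{C}$ and $\widehat{\mathbb{C}}=\mathbb{C}\cup\{\infty\}$ is the Riemann sphere. A holomorphic motion of a set $A\subset\widehat{\mathbb{C}}$ is a map $h:\mathbb{D}\times A\to\widehat{\mathbb{C}}$ such that: (i) for each fixed $z\in A$, the map $\lambda\mapsto h(\lambda,z)$ is holomorphic on $\mathbb{D}$ (as a map into $\widehat{\mathbb{C}}$); (ii) for each fixed $\lambda\in\mathbb{D}$, the map $z\mapsto h(\lambda,z)$ is injective on $A$; (iii) $h(0,z)=z$ for all $z\in A$. By the $\lambda$-lemma of Mañé, Sad and Sullivan, a holomorphic motion of $\widehat{\mathbb{C}}$ is jointly continuous in $(\lambda,z)$; in particular each $E_\lambda$ above is a compact subset of $\mathbb{C}$. The logarithmic capacity of a compact set $K\subset\mathbb{C}$ is $c(K):=\exp\bigl(-\inf_\mu I(\mu)\bigr)$, where the infimum is over all Borel probability measures $\mu$ supported on $K$ and $I(\mu):=-\iint \log|z-w|\,d\mu(z)\,d\mu(w)$;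 $c(K)=0$ if the infimum is $+\infty$. *)

(* Defs.v *)
From HB Require Import structures.
From mathcomp Require Import all_boot all_order all_algebra.
From mathcomp Require Import all_classical all_reals all_analysis.
From mathcomp.real_closed Require Import complex.

Set Implicit Arguments.
Unset Strict Implicit.
Unset Printing Implicit Defensive.

Import Order.TTheory GRing.Theory Num.Theory.
Import numFieldNormedType.Exports.

Local Open Scope classical_set_scope.
Local Open Scope ring_scope.

(* [R[i]^o] is [R[i]] seen as a one-dimensional normed space over itself:
   this alias carries the usual topology, and [derivable] at type
   [C R -> C R] takes limits over complex increments, i.e., it is complex
   differentiability. *)
Notation C R := (R[i]^o)%type.

Definition unit_disk (R : realType) : set (C R) := [set z | `|z| < 1].

(* [Some z] is the finite point z and [None] is the point at infinity. *)
Notation sphere R := (one_point_compactification (C R)).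

Definition infty (R : realType) : sphere R := None.

Definition embed (R : realType) (z : C R) : sphere R := Some z.

(* Chart z |-> z on the complement of infinity (the value at infinity is a
   dummy). *)
Definition chart_fin (R : realType) (p : sphere R) : C R :=
  if p is Some z then z else 0.

(* Chart z |-> 1/z, infinity |-> 0 on the complement of 0 (the value at 0 is a
   dummy). *)
Definition chart_inf (R : realType) (p : sphere R) : C R :=
  if p is Some z then z^-1 else 0.

(* A map from an open subset U of the plane to the sphere is holomorphic if it
   is continuous and holomorphic when read in the two charts.  Since U is open
   and f is continuous, f stays in the domain of the chart around each point
   considered, and only the values of f on U matter. *)
Definition holomorphic_sphere (R : realType) (U : set (C R))
    (f : C R -> sphere R) : Prop :=
  [/\ {within U, continuous f},
      forall z, U z -> f z <> infty R ->
        derivable (@chart_fin R \o f : C R -> C R) z 1 &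
      forall z, U z -> f z <> embed (0 : C R) ->
        derivable (@chart_inf R \o f : C R -> C R) z 1].

(* Only the restriction of h to the product of the unit disk and A matters. *)
Definition holomorphic_motion (R : realType) (A : set (sphere R))
    (h : C R -> sphere R -> sphere R) : Prop :=
  [/\ forall z, A z -> holomorphic_sphere (@unit_disk R) (fun lam => h lam z),
      forall lam, unit_disk lam -> {in A &, injective (h lam)} &
      forall z, A z -> h 0 z = z].

Definition borelC (R : realType) := g_sigma_algebraType (@open (C R)).

(* The inner integrand is -oo on the diagonal, since [lne 0 = -oo]. *)
Definition log_energy (R : realType) (mu : probability (borelC R) R) : \bar R :=
  (- \int[mu]_(w in setT) \int[mu]_(z in setT)
       lne (ComplexField.Normc.normc ((z : C R) - (w : C R)))%:E)%E.

(* The probability measure mu is carried by K; for K closed, this means that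
   the support of mu is contained in K. *)
Definition supported_on (R : realType) (K : set (C R))
    (mu : probability (borelC R) R) : Prop := mu (~` K) = 0%E.

(* For compact K the infimum is never -oo, so that [fine] is harmless, and the
   value is 0 when the infimum is +oo (in particular when K is empty), since
   [expeR -oo = 0]. *)
Definition capacity (R : realType) (K : set (C R)) : R :=
  fine (expeR (- ereal_inf
    [set log_energy mu | mu in [set mu | supported_on K mu]])).

(* The image of E at time lam, as a set of finite points. *)
Definition moved_set (R : realType) (h : C R -> sphere R -> sphere R)
    (E : set (C R)) (lam : C R) : set (C R) :=
  @embed R @^-1` (h lam @` (@embed R @` E)).

(* Main.v *)
Require Import Defs.
From mathcomp Require Import all_boot all_order all_algebra.
From mathcomp Require Import all_classical all_reals all_analysis.
From mathcomp.real_closed Require Import complex.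
From mathcomp Require Import measurable_realfun.
From mathcomp Require Import ring lra.
Import Order.TTheory GRing.Theory Num.Theory.
Import numFieldNormedType.Exports.
Import ComplexField.Normc.
Local Open Scope classical_set_scope.
Local Open Scope ring_scope.
Local Open Scope complex_scope.
Set Implicit Arguments.
Unset Strict Implicit.
Unset Printing Implicit Defensive.

(** Write f_z(l) for the position at time l of the point z.  For z <> w the
    difference f_z - f_w of two orbits is a holomorphic function on the disk
    without zeros, so that, as long as |f_z - f_w| <= b, the function

      u(l) = ln (b / |f_z(l) - f_w(l)|)

    is nonnegative and harmonic.  Harnack's inequality gives u(l) <= t u(l0)
    and u(l0) <= t u(l), where t depends only on l and l0, not on z and w, and
    tends to 1 as l tends to l0 ([harnack], [motion_distortion]).

    Up to the constant ln b, the energy of a measure is the double integral of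
    ln (b / |z - w|).  Let T be the homeomorphism f(., l) o f(., l0)^-1 from
    E_l0 to E_l.  The image under T of a probability measure on E_l0 is a
    probability measure on E_l, and the integrand grows at most by the factor t
    ([energy_transport]).  Hence the least energies V satisfy
    V(l) + ln b <= t (V(l0) + ln b), and the same with l and l0 exchanged.
    Either both are infinite and both capacities are 0, or both are finite and
    close to each other, and so are the capacities exp (- V)
    ([capacity_dist]).

    What remains is to bound the orbits of the points of E uniformly on compact
    subsets of the disk ([motion_bounded]).  This uses the motion of the whole
    plane.  The set of the points whose orbits are bounded by n is closed, by
    Harnack's inequality again ([closed_orbit_le]), so by Baire's theorem one of
    these sets contains a disk D, with centre a say ([closed_cover_interior]).
    The orbit of a point z outside D stays away from that of a: a smaller circle
    about a moves continuously without meeting either orbit, so its winding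
    number is always 0 about f_z and 1 about f_a, which is impossible if f_z and
    f_a come close ([outside_separated]).  So
    1 / (f_z - f_a) is bounded, and Harnack's inequality for this function
    bounds f_z from above.

    The function theory needed rests on Goursat's theorem for rectangles
    ([flux_eq0]).  Through the substitution z = p + exp s it yields the mean
    value property on circles ([circle_Re_gt_centre]), hence the maximum
    principle and Schwarz's lemma; the latter, applied to a Cayley transform, is
    Harnack's inequality for the real part of a holomorphic function
    ([harnack_Re]).  To pass from real parts to ln |f|, a logarithm of f is
    written as a sum of principal logarithms of quotients close to 1
    ([disc_log]); the same device gives the homotopy invariance of winding
    numbers ([loop_log_chain]). *)

(** * The modulus as a real number, and epsilon-delta criteria *)

Section Complex.
Context {R : realType}.
Implicit Types (z w : C R) (f g : C R -> C R) (x y : R).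

Notation N := (@normc R).

Lemma normE z : `|z| = (N z)%:C.
Proof. by case: z => a b; rewrite normc_def. Qed.

Lemma normc_ge0 z : 0 <= N z.
Proof. by rewrite -ler0c -normE. Qed.

Lemma ler_normcD z w : N (z + w) <= N z + N w.
Proof. exact: le_normcD. Qed.

Lemma normc_eq0 z : (N z == 0) = (z == 0).
Proof. by apply/eqP/eqP => [/eq0_normc//|->]; rewrite normc0. Qed.

Lemma normc_gt0 z : (0 < N z) = (z != 0).
Proof. by rewrite lt_def normc_eq0 normc_ge0 andbT. Qed.

Lemma normc_distC z w : N (z - w) = N (w - z).
Proof. by rewrite -opprB normcN. Qed.

Lemma ler_Re_normc z : `|complex.Re z| <= N z.
Proof. by rewrite -lecR -normE; exact: normc_ge_Re. Qed.

Lemma ler_Im_normc z : `|complex.Im z| <= N z.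
Proof.
have := ler_Re_normc (z * 'i%C); rewrite ReiNIm normrN normcM.
by rewrite /= (expr0n _ 2) /= add0r expr1n sqrtr1 mulr1.
Qed.

Lemma sqr_normcE z : N z ^+ 2 = complex.Re z ^+ 2 + complex.Im z ^+ 2.
Proof. by case: z => a b; rewrite /= sqr_sqrtr// addr_ge0// sqr_ge0. Qed.

Lemma nbhs_normcP z (P : set (C R)) :
  nbhs z P <-> exists2 d : R, 0 < d & forall w, N (w - z) < d -> P w.
Proof.
split=> [/nbhs_ballP[[d d']]|[d d0 dP]].
  move=> /= /andP[/eqP/= dE d0 /= H]. exists d => // w wd; apply: H.
  rewrite /ball /= normE ltcE /= dE eqxx /=. by rewrite normc_distC.
apply/nbhs_ballP; exists d%:C => /=; first by rewrite ltcR.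
by move=> w; rewrite /ball /= normE ltcR normc_distC => /dP.
Qed.

Lemma cvg_normcP (T : Type) (F : set_system T) (FF : Filter F) (f : T -> C R) z :
  f @ F --> z <-> forall e : R, 0 < e -> \forall t \near F, N (f t - z) < e.
Proof.
split=> [H e e0|H].
  apply: (H [set w | N (w - z) < e]).
  by apply/nbhs_normcP; exists e.
by move=> P /nbhs_normcP[d d0 dP]; near do apply: dP; exact: H.
Unshelve. all: by end_near. Qed.

Lemma continuous_normcP f z : {for z, continuous f} <->
  forall e : R, 0 < e -> exists2 d : R, 0 < d &
    forall w, N (w - z) < d -> N (f w - f z) < e.
Proof.
split=> [/cvg_normcP H e e0|H].
  by have /nbhs_normcP := H _ e0.
by apply/(@cvg_normcP _ (nbhs z)) => e e0; apply/nbhs_normcP/H.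
Qed.

(** Division by w - z is avoided, so that the condition also makes sense at
    w = z and can be checked by algebra alone. *)
Lemma derivable_normcP f z : derivable f z 1 <->
  exists k : C R, forall e : R, 0 < e -> exists2 d : R, 0 < d &
    forall w, N (w - z) < d -> N (f w - f z - k * (w - z)) <= e * N (w - z).
Proof.
split=> [/cvg_ex[k /(@cvg_normcP _ (dnbhs (0 : C R))) H]|[k H]].
  exists k => e e0; have /nbhs_normcP [d d0 dP] := H _ e0.
  exists d => // w wd; have [->|wz] := eqVneq w z.
    by rewrite !subrr mulr0 subrr normc0 mulr0.
  have wz0 : w - z != 0 by rewrite subr_eq0.
  have /= := dP (w - z); rewrite subr0 => /(_ wd wz0).
  rewrite /GRing.scale /= mulr1 subrK => h.
  have -> : f w - f z - k * (w - z) =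
      ((w - z)^-1 * (f w - f z) - k) * (w - z).
    by rewrite mulrBl mulrAC mulVf// mul1r.
  by rewrite normcM ler_wpM2r ?normc_ge0 ?ltW.
apply/cvg_ex; exists k; apply/(@cvg_normcP _ (dnbhs (0 : C R))) => e e0.
have [d d0 dP] := H _ (divr_gt0 e0 (ltr0Sn _ 1)).
apply/nbhs_normcP; exists d => // w; rewrite subr0 => wd w0.
have := dP (w + z); rewrite addrK => /(_ wd) h.
rewrite /GRing.scale /= mulr1.
have -> : w^-1 * (f (w + z) - f z) - k = w^-1 * (f (w + z) - f z - k * w).
  by rewrite [RHS]mulrBr [k * w]mulrC mulrA mulVf// mul1r.
rewrite normcM normcV mulrC ltr_pdivrMr ?normc_gt0//.
by rewrite (le_lt_trans h)// ltr_pM2r ?normc_gt0// gtr_pMr// invf_lt1// ltr1n.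
Qed.

Lemma derivable_continuous f z : derivable f z 1 -> {for z, continuous f}.
Proof. by move=> /derivable1_diffP; exact: differentiable_continuous. Qed.

Lemma derivable_compC f g z :
  derivable f z 1 -> derivable g (f z) 1 -> derivable (g \o f) z 1.
Proof.
move=> /derivable1_diffP df /derivable1_diffP dg.
by apply/derivable1_diffP; exact: (@differentiable_comp _ _ _ _ f g z df dg).
Qed.

Lemma continuous_Re z : {for z, continuous (@complex.Re R : C R -> R)}.
Proof.
apply/(@cvgrPdist_lt _ _ _ (nbhs z)) => e e0.
apply/nbhs_normcP; exists e => // w h.
rewrite distrC -raddfB. exact: le_lt_trans (ler_Re_normc _) h.
Qed.

Lemma continuous_Im z : {for z, continuous (@complex.Im R : C R -> R)}.
Proof.
apply/(@cvgrPdist_lt _ _ _ (nbhs z)) => e e0.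
apply/nbhs_normcP; exists e => // w h.
rewrite distrC -raddfB; exact: le_lt_trans (ler_Im_normc _) h.
Qed.

End Complex.

(** * Goursat's theorem for rectangles *)

Section Goursat.
Context {R : realType}.

Definition segint (f : R -> R) (a b : R) : R :=
  \int[lebesgue_measure]_(x in `[a, b]) f x.

Definition cont_on (f : R -> R) (a b : R) :=
  forall x, a <= x <= b -> {for x, continuous f}.

Lemma cont_on_sub f a b c d : a <= c -> d <= b -> cont_on f a b -> cont_on f c d.
Proof.
by move=> ac db h x /andP[cx xd]; apply: h; rewrite (le_trans ac cx) (le_trans xd db).
Qed.

Lemma cont_on_integrable f a b : cont_on f a b ->
  lebesgue_measure.-integrable `[a, b] (EFin \o f).
Proof.
move=> h; apply: continuous_compact_integrable; first exact: segment_compact.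
apply: continuous_in_subspaceT => x; rewrite inE /= in_itv /=; exact: h.
Qed.

Lemma segint_split f a m b : a <= m -> m <= b -> cont_on f a b ->
  segint f a b = segint f a m + segint f m b.
Proof.
move=> am mb h; rewrite /segint.
have := @Rintegral_itvB R f (BLeft a) (BRight b) m (cont_on_integrable h).
rewrite !bnd_simp => /(_ am mb) /eqP; rewrite subr_eq => /eqP ->.
rewrite addrC; congr (_ + _).
apply: Rintegral_itv_obnd_cbnd.
apply: integrableS (cont_on_integrable (cont_on_sub am (lexx _) h)) => //.
exact: subset_itv_oc_cc.
Qed.

Lemma segint_cst (k a b : R) : a <= b -> segint (fun=> k) a b = k * (b - a).
Proof.
move=> ab; rewrite /segint Rintegral_cst//= lebesgue_measure_itv /= lte_fin.
by case: ltgtP ab => //= ->; rewrite subrr mulr0.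
Qed.

Lemma le_segint f g a b : cont_on f a b -> cont_on g a b ->
  (forall x, a <= x <= b -> f x <= g x) -> segint f a b <= segint g a b.
Proof.
by move=> cf cg h; apply: le_Rintegral => //; do ?exact: cont_on_integrable.
Qed.

Lemma segintB f g a b : cont_on f a b -> cont_on g a b ->
  segint (fun x => f x - g x) a b = segint f a b - segint g a b.
Proof. by move=> cf cg; apply: RintegralB => //; exact: cont_on_integrable. Qed.

Lemma segint_near f (k e a b : R) : a <= b -> cont_on f a b ->
  (forall x, a <= x <= b -> `|f x - k| <= e) ->
  `|segint f a b - k * (b - a)| <= e * (b - a).
Proof.
move=> ab cf h; have cc c : cont_on (fun=> c) a b by move=> x _; exact: cvg_cst.
rewrite ler_distl -mulrBl -mulrDl -!segint_cst//; apply/andP.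
by split; apply: le_segint => // x /h; rewrite ler_distl => /andP[].
Qed.

Lemma nested_segments (S w : nat -> R) : (forall n, 0 <= w n) ->
  (forall n, S n <= S n.+1) -> (forall n, S n.+1 + w n.+1 <= S n + w n) ->
  exists x, forall n, S n <= x <= S n + w n.
Proof.
move=> w0 hl hr.
have ndS : {homo S : m n / (m <= n)%N >-> m <= n} by exact/nondecreasing_seqP.
have niS : {homo (fun n => S n + w n) : m n / (m <= n)%N >-> n <= m}.
  exact/nonincreasing_seqP.
have ub n : ubound (range S) (S n + w n).
  move=> _ [m _ <-]; have [mn|/ltnW nm] := leqP m n.
    by rewrite (le_trans (ndS _ _ mn))// lerDl.
  by apply: le_trans (niS _ _ nm); rewrite lerDl.
exists (sup (range S)) => n; apply/andP; split.
  by apply: ub_le_sup; [exists (S n + w n); exact: ub|exists n].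
by apply: sup_le_ub => //; exists (S 0%N), 0%N.
Qed.

(** If J does not vanish on a rectangle, one of its four quarters carries at
    least a quarter of the value; the nested quarters so obtained shrink to a
    point near which J is not negligible with respect to their area. *)
Lemma additive_rect_eq0 (J : R -> R -> R -> R -> R) (x0 y0 W H : R) :
  0 < W -> 0 < H ->
  (forall a m b c d, x0 <= a -> a <= m -> m <= b -> b <= x0 + W ->
     y0 <= c -> c <= d -> d <= y0 + H -> J a b c d = J a m c d + J m b c d) ->
  (forall a b c m d, x0 <= a -> a <= b -> b <= x0 + W ->
     y0 <= c -> c <= m -> m <= d -> d <= y0 + H -> J a b c d = J a b c m + J a b m d) ->
  (forall x y, x0 <= x <= x0 + W -> y0 <= y <= y0 + H -> forall e : R, 0 < e ->
     exists2 r : R, 0 < r & forall a b c d,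
       x0 <= a -> a <= x -> x <= b -> b <= x0 + W ->
       y0 <= c -> c <= y -> y <= d -> d <= y0 + H ->
       b - a + (d - c) < r -> `|J a b c d| <= e * (b - a + (d - c)) ^+ 2) ->
  J x0 (x0 + W) y0 (y0 + H) = 0.
Proof.
move=> W0 H0 Jx Jy Jloc; apply/eqP/negPn/negP => J0.
set j := `|J x0 (x0 + W) y0 (y0 + H)|.
have j0 : 0 < j by rewrite normr_gt0.
pose w (n : nat) := W / 2 ^+ n; pose h (n : nat) := H / 2 ^+ n.
have p2 (n : nat) : (0 : R) < 2 ^+ n by rewrite exprn_gt0.
have w00 : w 0%N = W by rewrite /w expr0 divr1.
have h00 : h 0%N = H by rewrite /h expr0 divr1.
have w0 n : 0 < w n by rewrite divr_gt0.
have h0 n : 0 < h n by rewrite divr_gt0.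
have wS n : w n = w n.+1 + w n.+1.
  by rewrite /w exprS; have := lt0r_neq0 (p2 n); move: (2 ^+ n) => z ?; field.
have hS n : h n = h n.+1 + h n.+1.
  by rewrite /h exprS; have := lt0r_neq0 (p2 n); move: (2 ^+ n) => z ?; field.
(* The rectangles of generation n that still carry enough of J; p is the
   lower left corner. *)
pose bad n (p : R * R) := [/\ x0 <= p.1, p.1 + w n <= x0 + W, y0 <= p.2,
  p.2 + h n <= y0 + H & j / 4 ^+ n <= `|J p.1 (p.1 + w n) p.2 (p.2 + h n)|].
have step (np : nat * (R * R)) : exists q : R * R, bad np.1 np.2 ->
    [/\ bad np.1.+1 q, np.2.1 <= q.1, q.1 + w np.1.+1 <= np.2.1 + w np.1,
       np.2.2 <= q.2 & q.2 + h np.1.+1 <= np.2.2 + h np.1].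
  case: np => n [x y] /=; have [B|] := pselect (bad n (x, y)); last first.
    by move=> ?; exists (0, 0).
  case: B => /= xx0 xW yy0 yH Jn.
  have wn := w0 n.+1; have hn := h0 n.+1; have wSn := wS n; have hSn := hS n.
  have e4 : j / 4 ^+ n = 4 * (j / 4 ^+ n.+1).
    rewrite exprS; have : (4 : R) ^+ n != 0 by rewrite expf_neq0.
    by move: (4 ^+ n) => z ?; field.
  set k := j / 4 ^+ n.+1 in e4 *.
  set J1 := J x (x + w n.+1) y (y + h n.+1).
  set J2 := J (x + w n.+1) (x + w n.+1 + w n.+1) y (y + h n.+1).
  set J3 := J x (x + w n.+1) (y + h n.+1) (y + h n.+1 + h n.+1).
  set J4 := J (x + w n.+1) (x + w n.+1 + w n.+1) (y + h n.+1) (y + h n.+1 + h n.+1).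
  have x1 : x0 <= x + w n.+1 by rewrite (le_trans xx0)// lerDl ltW.
  have y1 : y0 <= y + h n.+1 by rewrite (le_trans yy0)// lerDl ltW.
  have x2 : x + w n.+1 + w n.+1 <= x0 + W by rewrite -addrA -wSn.
  have y2 : y + h n.+1 + h n.+1 <= y0 + H by rewrite -addrA -hSn.
  have x3 : x + w n.+1 <= x0 + W by rewrite (le_trans _ x2)// lerDl ltW.
  have y3 : y + h n.+1 <= y0 + H by rewrite (le_trans _ y2)// lerDl ltW.
  have x4 : x <= x + w n.+1 by rewrite lerDl ltW.
  have y4 : y <= y + h n.+1 by rewrite lerDl ltW.
  have x5 : x + w n.+1 + w n.+1 <= x + w n by rewrite -addrA -wSn.
  have y5 : y + h n.+1 + h n.+1 <= y + h n by rewrite -addrA -hSn.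
  have x6 : x + w n.+1 <= x + w n by rewrite (le_trans _ x5)// lerDl ltW.
  have y6 : y + h n.+1 <= y + h n by rewrite (le_trans _ y5)// lerDl ltW.
  have x7 : x <= x + w n by rewrite lerDl ltW.
  have y7 : y <= y + h n by rewrite lerDl ltW.
  have JE : J x (x + w n) y (y + h n) = (J1 + J2) + (J3 + J4).
    rewrite (@Jy _ _ _ (y + h n.+1))//.
    rewrite (@Jx x (x + w n.+1) (x + w n) y (y + h n.+1))//.
    rewrite (@Jx x (x + w n.+1) (x + w n) (y + h n.+1) (y + h n))//.
    by rewrite /J1 /J2 /J3 /J4 wSn hSn !addrA.
  have : [\/ k <= `|J1|, k <= `|J2|, k <= `|J3| | k <= `|J4|].
    move: Jn; rewrite JE => Jn.
    have := ler_normD (J1 + J2) (J3 + J4); have := ler_normD J1 J2.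
    have := ler_normD J3 J4.
    have [|k1] := leP k `|J1|; first by constructor.
    have [|k2] := leP k `|J2|; first by constructor.
    have [|k3] := leP k `|J3|; first by constructor.
    have [|k4] := leP k `|J4|; first by constructor.
    by lra.
  case=> Jk; [exists (x, y)|exists (x + w n.+1, y)|exists (x, y + h n.+1)|
    exists (x + w n.+1, y + h n.+1)] => _; by (split=> /=; [split|..]).
have [F FP] := choice step.
have {}FP n p : bad n p -> [/\ bad n.+1 (F (n, p)), p.1 <= (F (n, p)).1,
    (F (n, p)).1 + w n.+1 <= p.1 + w n, p.2 <= (F (n, p)).2 &
    (F (n, p)).2 + h n.+1 <= p.2 + h n] := FP (n, p).
pose S := fix S n := if n is m.+1 then F (m, S m) else (x0, y0).
have Sbad n : bad n (S n).
  elim: n => [|n IH]; last by have [] := FP _ _ IH.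
  by split; rewrite /= ?w00 ?h00 ?expr0 ?divr1.
have SP n := FP _ _ (Sbad n).
have [X Xn] : exists X, forall n, (S n).1 <= X <= (S n).1 + w n.
  by apply: nested_segments => n; [rewrite ltW|have [] := SP n|have [] := SP n].
have [Y Yn] : exists Y, forall n, (S n).2 <= Y <= (S n).2 + h n.
  by apply: nested_segments => n; [rewrite ltW|have [] := SP n|have [] := SP n].
have XW : x0 <= X <= x0 + W.
  by have := Xn 0%N; rewrite w00.
have YH : y0 <= Y <= y0 + H.
  by have := Yn 0%N; rewrite h00.
(* The factor 2 makes the local bound half of the lower bound j / 4 ^ n. *)
pose e := j / (2 * (W + H) ^+ 2).
have e0 : 0 < e by rewrite divr_gt0 ?mulr_gt0 ?exprn_gt0 ?addr_gt0.
have [r r0 rP] := Jloc _ _ XW YH _ e0.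
have [n nP] : exists n : nat, w n + h n < r.
  have rWH : 0 < r / (W + H) by rewrite divr_gt0 ?addr_gt0.
  have /cvgrPdist_lt/(_ _ rWH)[n _ Hn] : (2^-1 : R) ^+ n @[n --> \oo] --> (0 : R).
    by apply: cvg_expr; rewrite ger0_norm// invf_lt1// ltr1n.
  exists n; have := Hn n (leqnn _).
  rewrite /= sub0r normrN ger0_norm ?exprn_ge0// exprVn.
  rewrite ltr_pdivlMr ?addr_gt0// => ?.
  by rewrite /w /h -mulrDl mulrC.
have [bx bxW by_ byH bJ] := Sbad n.
have /andP[? ?] := Xn n; have /andP[? ?] := Yn n.
have := rP (S n).1 ((S n).1 + w n) (S n).2 ((S n).2 + h n).
rewrite ![_ + w n - _]addrAC ![_ + h n - _]addrAC !subrr !add0r.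
move=> /(_ bx); do 8!(move=> /(_ ltac:(assumption))).
apply/negP; rewrite -ltNge (lt_le_trans _ bJ)//.
have -> : e * (w n + h n) ^+ 2 = j / 4 ^+ n / 2.
  have -> : (4 : R) ^+ n = 2 ^+ n * 2 ^+ n by rewrite -exprMn -natrM.
  rewrite /e /w /h; have := lt0r_neq0 (p2 n); move: (2 ^+ n) => z ?.
  have : W + H != 0 by rewrite lt0r_neq0 ?addr_gt0.
  by move=> ?; field; apply/andP.
have : 0 < j / 4 ^+ n by rewrite divr_gt0 ?exprn_gt0.
by lra.
Qed.

End Goursat.

(** * The complex exponential and the mean value property *)

Section MeanValue.
Context {R : realType}.
Implicit Types (z w p : C R) (f g G : C R -> C R) (x y : R).

Notation N := (@normc R).

Lemma normcR x : N (x +i* 0) = `|x|.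
Proof. by rewrite /= (expr0n _ 2) /= addr0 sqrtr_sqr. Qed.

Lemma normcI y : N (0 +i* y) = `|y|.
Proof. by rewrite /= (expr0n _ 2) /= add0r sqrtr_sqr. Qed.

Lemma normc_le_add x y : N (x +i* y) <= `|x| + `|y|.
Proof.
have -> : x +i* y = (x +i* 0) + (0 +i* y) :> C R by congr Complex; ring.
by rewrite (le_trans (ler_normcD _ _))// normcR normcI.
Qed.

Lemma continuous_horizontal g x c : {for (x +i* c : C R), continuous g} ->
  {for x, continuous (fun t => complex.Im (g (t +i* c)))}.
Proof.
move=> /continuous_normcP H; apply/(@cvgrPdist_lt _ _ _ (nbhs x)) => e e0.
have [d d0 dP] := H _ e0.
apply/nbhs_ballP; exists d => // t; rewrite /ball/= => xt.
rewrite distrC -raddfB (le_lt_trans (ler_Im_normc _))//; apply: dP.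
have -> : (t +i* c) - (x +i* c) = (t - x) +i* 0 :> C R by congr Complex; ring.
by rewrite normcR distrC.
Qed.

Lemma continuous_vertical g a y : {for (a +i* y : C R), continuous g} ->
  {for y, continuous (fun t => complex.Re (g (a +i* t)))}.
Proof.
move=> /continuous_normcP H; apply/(@cvgrPdist_lt _ _ _ (nbhs y)) => e e0.
have [d d0 dP] := H _ e0.
apply/nbhs_ballP; exists d => // t; rewrite /ball/= => xt.
rewrite distrC -raddfB (le_lt_trans (ler_Re_normc _))//; apply: dP.
have -> : (a +i* t) - (a +i* y) = 0 +i* (t - y) :> C R by congr Complex; ring.
by rewrite normcI distrC.
Qed.

(** The imaginary part of the integral of g along the boundary of the
    rectangle; on its vertical sides only the real part of g contributes, which
    is what the mean value property needs. *)
Definition flux g (a b c d : R) : R :=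
  segint (fun x => complex.Im (g (x +i* c))) a b
  - segint (fun x => complex.Im (g (x +i* d))) a b
  + (segint (fun y => complex.Re (g (b +i* y))) c d
     - segint (fun y => complex.Re (g (a +i* y))) c d).

(** An affine function has no flux, so the flux of g through a small rectangle
    is that of the remainder of its expansion to first order, which is
    negligible with respect to the square of the diameter. *)
Lemma flux_eq0 g (x0 y0 W H : R) : 0 < W -> 0 < H ->
  (forall x y, x0 <= x <= x0 + W -> y0 <= y <= y0 + H ->
     derivable g (x +i* y : C R) 1) ->
  flux g x0 (x0 + W) y0 (y0 + H) = 0.
Proof.
move=> W0 H0 dg.
have ch c a b : y0 <= c <= y0 + H -> x0 <= a -> b <= x0 + W ->
    cont_on (fun x => complex.Im (g (x +i* c))) a b.
  move=> hc xa bx x /andP[ax xb]; apply: continuous_horizontal.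
  by apply/derivable_continuous/dg => //; rewrite (le_trans xa ax) (le_trans xb bx).
have cv a c d : x0 <= a <= x0 + W -> y0 <= c -> d <= y0 + H ->
    cont_on (fun y => complex.Re (g (a +i* y))) c d.
  move=> ha yc dy y /andP[cy yd]; apply: continuous_vertical.
  by apply/derivable_continuous/dg => //; rewrite (le_trans yc cy) (le_trans yd dy).
apply: additive_rect_eq0 => //.
- move=> a m b c d xa am mb bx yc cd dy; rewrite /flux.
  rewrite (@segint_split _ _ a m b)//; last by apply: ch => //; lra.
  rewrite (@segint_split _ (fun x => complex.Im (g (x +i* d))) a m b)//.
    by ring.
  by apply: ch => //; lra.
- move=> a b c m d xa ab bx yc cm md dy; rewrite /flux.
  rewrite (@segint_split _ (fun y => complex.Re (g (b +i* y))) c m d)//; last first.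
    by apply: cv => //; lra.
  rewrite (@segint_split _ (fun y => complex.Re (g (a +i* y))) c m d)//.
    by ring.
  by apply: cv => //; lra.
- move=> x y hx hy e e0.
  have /derivable_normcP[k kP] := dg _ _ hx hy.
  have [r r0 rP] := kP _ (divr_gt0 e0 (ltr0Sn _ 1)).
  exists r => // a b c d xa ax xb bx yc cy yd dy.
  set s := b - a + (d - c) => sr.
  have sP t u : a <= t <= b -> c <= u <= d ->
      N (g (t +i* u) - g (x +i* y) - k * ((t +i* u) - (x +i* y))) <= e / 2 * s.
    move=> ht hu.
    have ts : N ((t +i* u) - (x +i* y)) <= s.
      apply: le_trans (normc_le_add _ _) _.
      have : `|t - x| <= b - a by rewrite ler_norml; lra.
      have : `|u - y| <= d - c by rewrite ler_norml; lra.
      by rewrite /s; lra.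
    apply: le_trans (rP _ (le_lt_trans ts sr)) _.
    by rewrite ler_wpM2l//; lra.
  have hI t : a <= t <= b -> `|complex.Im (g (t +i* c)) -
      complex.Im (g (t +i* d)) - complex.Re k * (c - d)| <= e * s.
    move=> ht.
    have hc : c <= c <= d by lra.
    have hd : c <= d <= d by lra.
    have := le_trans (ler_Im_normc _) (sP _ _ ht hc).
    have := le_trans (ler_Im_normc _) (sP _ _ ht hd).
    move: (g (Complex t c)) (g (Complex t d)) (g (Complex x y)) (k)
      => [p1 p2] [q1 q2] [m1 m2] [k1 k2] /=.
    by rewrite !ler_norml => /andP[? ?] /andP[? ?]; apply/andP; split; lra.
  have hR u : c <= u <= d -> `|complex.Re (g (b +i* u)) -
      complex.Re (g (a +i* u)) - complex.Re k * (b - a)| <= e * s.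
    move=> hu.
    have ha : a <= a <= b by lra.
    have hb : a <= b <= b by lra.
    have := le_trans (ler_Re_normc _) (sP _ _ ha hu).
    have := le_trans (ler_Re_normc _) (sP _ _ hb hu).
    move: (g (Complex a u)) (g (Complex b u)) (g (Complex x y)) (k)
      => [p1 p2] [q1 q2] [m1 m2] [k1 k2] /=.
    by rewrite !ler_norml => /andP[? ?] /andP[? ?]; apply/andP; split; lra.
  have ab : a <= b by lra.
  have cd : c <= d by lra.
  have c1 : cont_on (fun x => complex.Im (g (x +i* c))) a b by apply: ch => //; lra.
  have c2 : cont_on (fun x => complex.Im (g (x +i* d))) a b by apply: ch => //; lra.
  have c3 : cont_on (fun x => complex.Re (g (b +i* x))) c d by apply: cv => //; lra.
  have c4 : cont_on (fun x => complex.Re (g (a +i* x))) c d by apply: cv => //; lra.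
  rewrite /flux -!segintB//.
  have := segint_near ab _ hI; have := segint_near cd _ hR.
  set I1 := segint _ _ _; set I2 := segint _ _ _.
  have -> : e * s ^+ 2 = e * s * (b - a) + e * s * (d - c) by rewrite /s; ring.
  move=> i1 i2.
  have /i1 {}i1 : cont_on (fun x => complex.Re (g (b +i* x)) - complex.Re (g (a +i* x))) c d.
    by move=> t ht; apply: cvgB; [exact: c3|exact: c4].
  have /i2 {}i2 : cont_on (fun x => complex.Im (g (x +i* c)) - complex.Im (g (x +i* d))) a b.
    by move=> t ht; apply: cvgB; [exact: c1|exact: c2].
  move: i1 i2; rewrite !ler_norml => /andP[? ?] /andP[? ?].
  by apply/andP; split; lra.
Qed.

Lemma is_derive0_remainder (f : R -> R) (k : R) : is_derive (0 : R) 1 f k ->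
  forall e : R, 0 < e -> exists2 d : R, 0 < d &
    forall x, `|x| < d -> `|f x - f 0 - k * x| <= e * `|x|.
Proof.
move=> [fd <-] e e0.
have /cvgrPdist_lt/(_ _ e0) := fd.
rewrite -/(nbhs _ _) => /nbhs_ballP[d d0 dP]; exists d => // x xd.
have [->|x0] := eqVneq x 0; first by rewrite subrr mulr0 subrr !normr0 mulr0.
have := dP x; rewrite /ball /= sub0r normrN => /(_ xd x0).
rewrite /GRing.scale /= mulr1 addr0 -/(derive f 0 1) => h.
have -> : f x - f 0 - 'D_1 f 0 * x = - (('D_1 f 0 - x^-1 * (f x - f 0)) * x).
  by rewrite mulrBl opprB mulrAC mulVf// mul1r.
by rewrite normrN normrM ler_wpM2r// ltW.
Qed.

Definition cexp z : C R :=
  (expR (complex.Re z) * cos (complex.Im z)) +i*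
  (expR (complex.Re z) * sin (complex.Im z)).

Lemma cexpD z w : cexp (z + w) = cexp z * cexp w.
Proof.
case: z w => [a b] [c d]; rewrite /cexp /= expRD cosD sinD.
by congr Complex; ring.
Qed.

Lemma cexp0 : cexp 0 = 1.
Proof. by rewrite /cexp /= expR0 cos0 sin0 mulr1 mulr0. Qed.

Lemma normc_cexp z : N (cexp z) = expR (complex.Re z).
Proof.
by rewrite /= !exprMn -mulrDr cos2Dsin2 mulr1 sqrtr_sqr ger0_norm.
Qed.

Lemma cexp_neq0 z : cexp z != 0.
Proof. by rewrite -normc_gt0 normc_cexp expR_gt0. Qed.

Lemma cexpN z : cexp (- z) = (cexp z)^-1.
Proof.
by apply: (mulfI (cexp_neq0 z)); rewrite -cexpD subrr cexp0 mulfV// cexp_neq0.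
Qed.

Lemma cexp_remainder0 (e : R) : 0 < e -> exists2 d : R, 0 < d &
  forall z, N z < d -> N (cexp z - 1 - z) <= e * N z.
Proof.
(* The estimates below add up to at most 6 e1 N z. *)
move=> e0; pose e1 := Num.min (e / 7) 1.
have e10 : 0 < e1 by rewrite /e1 lt_min ltr01 divr_gt0.
have e1e : 7 * e1 <= e.
  have : e1 <= e / 7 by rewrite /e1 ge_min lexx.
  lra.
have e11 : e1 <= 1 by rewrite /e1 ge_min lexx orbT.
have [d1 d10 h1] := is_derive0_remainder (is_derive_expR (0 : R)) e10.
have [d2 d20 h2] := is_derive0_remainder (is_derive_cos (0 : R)) e10.
have [d3 d30 h3] := is_derive0_remainder (is_derive_sin (0 : R)) e10.
pose d := Num.min (Num.min d1 d2) (Num.min d3 (e1 / 4)).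
have d0 : 0 < d by rewrite /d !lt_min d10 d20 d30 divr_gt0.
exists d => // -[x y] zd; pose n : R := N (x +i* y); rewrite -/n in zd *.
have xn : `|x| <= n := ler_Re_normc (x +i* y).
have yn : `|y| <= n := ler_Im_normc (x +i* y).
move: (zd); rewrite !lt_min => /andP[/andP[nd1 nd2] /andP[nd3 nd4]].
have := h1 _ (le_lt_trans xn nd1); have := h2 _ (le_lt_trans yn nd2).
have := h3 _ (le_lt_trans yn nd3).
rewrite expR0 cos0 sin0 oppr0 mul0r !subr0 addr0 !mul1r => hs hc he.
have ex : `|expR x - 1| <= 2 * n.
  have -> : expR x - 1 = (expR x - 1 - x) + x by ring.
  rewrite (le_trans (ler_normD _ _))//.
  have : e1 * `|x| <= 1 * `|x| by rewrite ler_wpM2r.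
  lra.
have ex2 : `|expR x| <= 2.
  have -> : expR x = (expR x - 1) + 1 by ring.
  by rewrite (le_trans (ler_normD _ _))// normr1; lra.
have b1 : `|expR x * (cos y - 1)| <= 2 * (e1 * `|y|).
  by rewrite normrM ler_pM.
have b2 : `|expR x * (sin y - y)| <= 2 * (e1 * `|y|).
  by rewrite normrM ler_pM.
have b3 : `|(expR x - 1) * y| <= e1 * `|y|.
  by rewrite normrM ler_wpM2r//; lra.
have -> : cexp (x +i* y) - 1 - (x +i* y) =
   ((expR x - 1 - x) + expR x * (cos y - 1)) +i*
   (expR x * (sin y - y) + (expR x - 1) * y) :> C R.
  by rewrite /cexp /=; congr Complex; ring.
apply: le_trans (normc_le_add _ _) _.
have := ler_normD (expR x - 1 - x) (expR x * (cos y - 1)).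
have := ler_normD (expR x * (sin y - y)) ((expR x - 1) * y).
have : e1 * `|x| <= e1 * n by rewrite ler_wpM2l// ltW.
have : e1 * `|y| <= e1 * n by rewrite ler_wpM2l// ltW.
have : 7 * e1 * n <= e * n by rewrite ler_wpM2r// /n normc_ge0.
have : 0 <= e1 * n by rewrite mulr_ge0 ?normc_ge0 ?ltW.
by lra.
Qed.

Lemma cexp_remainder z (e : R) : 0 < e -> exists2 d : R, 0 < d &
  forall w, N (w - z) < d ->
    N (cexp w - cexp z - cexp z * (w - z)) <= e * N (w - z).
Proof.
move=> e0; have c0 : 0 < N (cexp z) by rewrite normc_gt0 cexp_neq0.
have [d d0 dP] := cexp_remainder0 (divr_gt0 e0 c0).
exists d => // w /dP h.
have -> : cexp w - cexp z - cexp z * (w - z) =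
    cexp z * (cexp (w - z) - 1 - (w - z)).
  by rewrite !mulrBr -cexpD mulr1 (addrC z) subrK.
by rewrite normcM mulrC -ler_pdivlMr// mulrAC.
Qed.

Lemma derivable_cexp z : derivable cexp z 1.
Proof.
by apply/derivable_normcP; exists (cexp z) => e; exact: cexp_remainder.
Qed.

(** The mean value property, in the form used by the maximum principle.  In the
    coordinate s given by z = p + exp s, the punctured disk is a half-strip
    whose horizontal sides have opposite fluxes; so the mean of Re G is the same
    on all circles, and it tends to Re (G p) as the radius tends to 0.  Since
    the centre itself is never reached, G need only be continuous there. *)
Lemma circle_Re_gt_centre G p (r0 r e : R) : 0 < e -> 0 < r -> r < r0 ->
  (forall z, 0 < N (z - p) < r0 -> derivable G z 1) ->
  {for p, continuous G} ->
  exists2 z, N (z - p) = r & complex.Re (G p) - e < complex.Re (G z).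
Proof.
move=> e0 rgt0 rr0 dG cG; apply: contrapT => H.
have {}H z : N (z - p) = r -> complex.Re (G z) <= complex.Re (G p) - e.
  by move=> zr; rewrite leNgt; apply/negP => h; apply: H; exists z.
have [d d0 dP] := (continuous_normcP _ _).1 cG _ (divr_gt0 e0 (ltr0Sn _ 1)).
have [m [m0 mr md]] : exists m : R, [/\ 0 < m, m < r & m < d].
  exists (Num.min d r / 2); have : Num.min d r <= d by rewrite ge_min lexx.
  have : Num.min d r <= r by rewrite ge_min lexx orbT.
  have : 0 < Num.min d r by rewrite lt_min d0.
  by move: (Num.min d r) => t ? ? ?; split; lra.
pose g s := G (p + cexp s).
have [a aE] : exists a : R, expR a = m by exists (ln m); rewrite lnK// posrE.
have [b bE] : exists b : R, expR b = r by exists (ln r); rewrite lnK// posrE.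
have W0 : 0 < b - a by rewrite subr_gt0 -ltr_expR aE bE.
have [T P0 [cT sT]] : exists2 T : R, 0 < T & cos T = 1 /\ sin T = 0.
  by exists (pi *+ 2); [rewrite mulrn_wgt0// pi_gt0|rewrite cos2pi sin2pi].
have Nc x y : N (p + cexp (x +i* y) - p) = expR x.
  by rewrite addrAC subrr add0r normc_cexp.
have dg x y : a <= x <= a + (b - a) -> 0 <= y <= 0 + T ->
    derivable g (x +i* y : C R) 1.
  move=> /andP[_]; rewrite (addrC (a)) subrK => xr _.
  apply: (@derivable_compC _ (fun s => p + cexp s)).
    by apply: derivableD; [exact: derivable_cst|exact: derivable_cexp].
  apply: dG; rewrite Nc expR_gt0/= (le_lt_trans _ rr0)//.
  by rewrite -bE ler_expR.
have := flux_eq0 W0 P0 dg.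
rewrite /flux (addrC (a)) subrK add0r.
have -> : (fun x => complex.Im (g (x +i* T))) =
          (fun x => complex.Im (g (x +i* 0))).
  by apply/funext => x; rewrite /g /cexp /= cT sT cos0 sin0.
rewrite subrr add0r => /eqP; rewrite subr_eq0 => /eqP E.
have cv x : a <= x <= b ->
    cont_on (fun y => complex.Re (g (x +i* y))) 0 T.
  move=> hx y hy; apply: continuous_vertical; apply: derivable_continuous.
  by apply: dg; rewrite ?add0r// (addrC (a)) subrK.
have cc (c : R) : cont_on (fun=> c) 0 T by move=> x _; exact: cvg_cst.
have mlr : a <= b by rewrite -subr_ge0 ltW.
have : segint (fun y => complex.Re (g (b +i* y))) 0 T <=
       segint (fun=> complex.Re (G p) - e) 0 T.
  apply: le_segint; [by apply: cv; rewrite mlr lexx|exact: cc|].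
  by move=> y _; apply: H; rewrite Nc.
have : segint (fun=> complex.Re (G p) - e / 2) 0 T <=
       segint (fun y => complex.Re (g (a +i* y))) 0 T.
  apply: le_segint; [exact: cc|by apply: cv; rewrite mlr lexx|].
  move=> y _; have := dP (p + cexp (a +i* y)).
  rewrite Nc aE => /(_ md) /(le_lt_trans (ler_Re_normc _)).
  rewrite raddfB /= ltr_norml /g => /andP[+ _].
  by rewrite ltrBrDl => /ltW.
rewrite E (segint_cst _ (ltW P0)) (segint_cst _ (ltW P0)) => h1 h2.
have := le_trans h1 h2; rewrite subr0 (ler_pM2r P0) lerD2l lerN2.
by apply/negP; rewrite -ltNge gtr_pMr// invf_lt1// ltr1n.
Qed.

End MeanValue.

(** * Maximum principle, Schwarz's lemma, Harnack's inequality for real parts *)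

Section MaximumPrinciple.
Context {R : realType}.
Implicit Types (z w p c : C R) (f g F G : C R -> C R) (x y r : R).

Notation N := (@normc R).

Lemma continuous_Complex :
  continuous (fun p : R * R => (p.1 +i* p.2 : C R)).
Proof.
move=> p; apply/(@cvg_normcP _ _ (nbhs p)) => e e0.
have e2 : 0 < e / 2 by rewrite divr_gt0.
have h1 : \forall t \near p, `|p.1 - t.1| < e / 2.
  have /cvgrPdist_lt : t.1 @[t --> p] --> p.1 by case: (p) => a b; exact: cvg_fst.
  exact.
have h2 : \forall t \near p, `|p.2 - t.2| < e / 2.
  have /cvgrPdist_lt : t.2 @[t --> p] --> p.2 by case: (p) => a b; exact: cvg_snd.
  exact.
near=> t.
have t1 : `|t.1 - p.1| < e / 2 by rewrite distrC; near: t.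
have t2 : `|t.2 - p.2| < e / 2 by rewrite distrC; near: t.
rewrite (_ : _ - _ = (t.1 - p.1) +i* (t.2 - p.2)); last by congr Complex; ring.
by apply: le_lt_trans (normc_le_add _ _) _; lra.
Unshelve. all: by end_near. Qed.

Lemma compact_disc c r : compact [set z : C R | N (z - c) <= r].
Proof.
pose S := ((fun p : R * R => (p.1 +i* p.2 : C R)) @`
  (`[complex.Re c - r, complex.Re c + r] `*`
   `[complex.Im c - r, complex.Im c + r])).
apply: (@subclosed_compact _ _ S).
- rewrite -[X in closed X]setCK; apply: open_closedC.
  rewrite openE => z /= /negP; rewrite -ltNge => rz.
  apply/nbhs_normcP; exists (N (z - c) - r); first by rewrite subr_gt0.
  move=> w wz; apply/negP; rewrite -ltNge.
  have := ler_normcD (w - c) (z - w); rewrite normc_distC in wz.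
  by rewrite addrC addrA subrK; lra.
- apply: continuous_compact.
    by apply: continuous_subspaceT; exact: continuous_Complex.
  by apply: compact_setX; exact: segment_compact.
- move=> z /= zc; exists (complex.Re z, complex.Im z); last by case: z {zc}.
  have := le_trans (ler_Re_normc _) zc; have := le_trans (ler_Im_normc _) zc.
  rewrite !raddfB /= !ler_distl !in_itv /= => /andP[-> ->] /andP[-> ->].
  by [].
Qed.

Lemma disc_EVT (f : C R -> R) c r : 0 <= r ->
  (forall z, N (z - c) <= r -> {for z, continuous f}) ->
  exists2 p, N (p - c) <= r & forall z, N (z - c) <= r -> f z <= f p.
Proof.
move=> r0 cf.
have [||p] := @compact_EVT_max _ R f _ _ (@compact_disc c r).
- by exists c; rewrite /= subrr normc0.
- by apply: continuous_in_subspaceT => z; rewrite inE => /cf.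
- rewrite inE => pr pP; exists p => // z zr; apply: pP.
  by rewrite inE.
Qed.

Lemma continuous_normc_comp f z : {for z, continuous f} ->
  {for z, continuous (fun w => N (f w))}.
Proof.
move=> /continuous_normcP H; apply/(@cvgrPdist_lt _ _ _ (nbhs z)) => e e0.
have [d d0 dP] := H _ e0; apply/nbhs_normcP; exists d => // w /dP h.
have := ler_normcD (f w - f z) (f z); have := ler_normcD (f z - f w) (f w).
by rewrite !subrK (normc_distC (f z)) ltr_norml; lra.
Qed.

Lemma unimodular_Re w : exists2 u : C R, N u = 1 & complex.Re (u * w) = N w.
Proof.
have [->|w0] := eqVneq w 0; first by exists 1; rewrite ?normc1// mulr0 normc0.
have n0 : 0 < N w by rewrite normc_gt0.
exists ((complex.Re w / N w) +i* (- complex.Im w / N w)).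
  apply/eqP; rewrite -[_ == _](@eqrXn2 _ 2)// ?normc_ge0// expr1n sqr_normcE /=.
  by rewrite !expr_div_n sqrrN -mulrDl -sqr_normcE divff// expf_neq0// gt_eqF.
case: w w0 n0 => a b w0 n0 /=; set n := Num.sqrt _ in n0 *.
have nn : n ^+ 2 = a ^+ 2 + b ^+ 2 by rewrite sqr_sqrtr// addr_ge0// sqr_ge0.
have n1 : n != 0 by rewrite gt_eqF.
by apply: (mulIf n1); rewrite -expr2 nn; field.
Qed.

(** The point 0 may be a removable singularity: this is the case for f z / z in
    Schwarz's lemma. *)
Lemma maximum_principle F (r0 r B : R) : 0 < r -> r < r0 ->
  (forall z, 0 < N z < r0 -> derivable F z 1) -> {for 0, continuous F} ->
  (forall z, N z = r -> N (F z) <= B) -> forall z, N z <= r -> N (F z) <= B.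
Proof.
move=> rgt0 rr0 dF cF0 FB z0 z0r; rewrite leNgt; apply/negP => Bz.
have cF z : N z < r0 -> {for z, continuous F}.
  move=> zr; have [->//|zn0] := eqVneq z 0.
  by apply/derivable_continuous/dF; rewrite normc_gt0 zn0.
pose h := (N (F z0) - B) / (2 * r ^+ 2).
have h0 : 0 < h by rewrite divr_gt0 ?subr_gt0// mulr_gt0// exprn_gt0.
have hr : B + h * r ^+ 2 < N (F z0).
  have -> : h * r ^+ 2 = (N (F z0) - B) / 2.
    by rewrite /h; field; rewrite gt_eqF.
  by move: (N (F z0)) Bz => t ?; lra.
(* The term h |z|^2 makes the mean of psi over every circle strictly larger
   than its value at the centre; h is small enough for the maximum of psi on
   the closed disk not to be attained on its boundary. *)
pose psi z := N (F z) + h * N z ^+ 2.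
have [c] : exists2 p, N (p - 0) <= r & forall z, N (z - 0) <= r -> psi z <= psi p.
  apply: disc_EVT => [|z]; first exact: ltW.
  rewrite subr0 => zr.
  have cNF : {for z, continuous (fun w => N (F w))}.
    by apply: continuous_normc_comp; apply: cF; rewrite (le_lt_trans zr).
  apply: (cvgD cNF).
  apply: cvgM; first exact: cvg_cst.
  have cN : {for z, continuous (fun w : C R => N w)}.
    have := @continuous_normc_comp id z; apply; exact: cvg_id.
  exact: (cvgM cN cN).
rewrite subr0 => cr cmax.
have psic : N (F z0) <= psi c.
  apply: le_trans (cmax z0 _); last by rewrite subr0.
  by rewrite lerDl mulr_ge0 ?sqr_ge0// ltW.
have [ceq|cne] := eqVneq (N c) r.
  have := FB _ ceq; move: psic; rewrite /psi ceq => h1 h2.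
  by have := le_lt_trans (lerD h2 (lexx _)) hr; rewrite ltNge h1.
have {cne}cr : N c < r by rewrite lt_neqAle cne.
have [u u1 uc] := unimodular_Re (F c).
(* On the circle of radius t about c, |z|^2 is |c|^2 + t^2 plus the real part
   of 2 (conj c) (z - c), so that Re G is a minorant of psi up to a constant. *)
pose G z := u * F z + (2 * h)%:C * conjc c * (z - c).
have [s s0 sP] : exists2 s : R, 0 < s &
    forall z, 0 < N (z - c) < s -> 0 < N z < r0.
  have [->|c0] := eqVneq c 0; first by exists r0; [exact: lt_trans rr0|move=> z; rewrite subr0].
  have Nc0 : 0 < N c by rewrite normc_gt0.
  exists (Num.min (N c) (r - N c)); first by rewrite lt_min Nc0 subr_gt0.
  move=> z; rewrite lt_min => /andP[_ /andP[z1 z2]].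
  have := ler_normcD z (c - z); have := ler_normcD (z - c) c.
  by rewrite addrCA subrr addr0 subrK (normc_distC c); lra.
pose t := Num.min s (r - N c) / 2.
have t0 : 0 < t by rewrite divr_gt0// lt_min s0 subr_gt0.
have ts : t < s.
  have : Num.min s (r - N c) <= s by rewrite ge_min lexx.
  by rewrite /t; move: (Num.min _ _) t0 => q; rewrite /t; lra.
have tr : t < r - N c.
  have : Num.min s (r - N c) <= r - N c by rewrite ge_min lexx orbT.
  have : 0 < Num.min s (r - N c) by rewrite lt_min s0 subr_gt0.
  by rewrite /t; move: (Num.min _ _) => q; lra.
have [|||z zt] := @circle_Re_gt_centre _ G c s t (h * t ^+ 2) _ t0 ts.
- by rewrite mulr_gt0// exprn_gt0.
- move=> z /sP zr; apply: derivableD.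
    by apply: derivableM; [exact: derivable_cst|exact: dF].
  apply: derivableM; first exact: derivable_cst.
  by apply: derivableB; [exact: derivable_id|exact: derivable_cst].
- have cFc : {for c, continuous F} by apply: cF; exact: lt_trans rr0.
  have cu : {for c, continuous (cst u : C R -> C R)}.
    by apply/derivable_continuous/derivable_cst.
  have cL : {for c, continuous (fun z => (2 * h)%:C * conjc c * (z - c) : C R)}.
    apply/derivable_continuous; apply: derivableM; first exact: derivable_cst.
    by apply: derivableB; [exact: derivable_id|exact: derivable_cst].
  exact: (continuousD (continuousM cu cFc) cL).
apply/negP; rewrite -leNgt /G subrr mulr0 addr0 uc raddfD /=.
have zr : N z <= r.
  have := ler_normcD (z - c) c; rewrite subrK zt; lra.
have := cmax z; rewrite subr0 => /(_ zr).
have := ler_Re_normc (u * F z); rewrite normcM u1 mul1r ler_norml => /andP[_].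
have -> : complex.Re ((2 * h)%:C * conjc c * (z - c)) =
    h * (N z ^+ 2 - N c ^+ 2 - t ^+ 2).
  rewrite -zt !sqr_normcE.
  by case: (z) (c) => [z1 z2] [c1 c2] /=; ring.
by rewrite /psi; move: (N (F z)) (N (F c)) => x y; lra.
Qed.

(** The maximum principle for f z / z on disks of radius r < r0; then r tends
    to r0. *)
Lemma schwarz f (r0 B : R) : 0 < r0 -> (forall z, N z < r0 -> derivable f z 1) ->
  f 0 = 0 -> (forall z, N z < r0 -> N (f z) <= B) ->
  forall z, N z < r0 -> N (f z) * r0 <= B * N z.
Proof.
move=> r00 df f0 fB z zr.
have [->|z0] := eqVneq z 0; first by rewrite f0 normc0 mul0r mulr0.
have Nz0 : 0 < N z by rewrite normc_gt0.
have /derivable_normcP[k kP] : derivable f 0 1 by apply: df; rewrite normc0.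
pose F w := if w == 0 then k else f w / w.
have Ff w : w != 0 -> F w = f w / w by rewrite /F => /negPf ->.
have dF w : 0 < N w < r0 -> derivable F w 1.
  rewrite normc_gt0 => /andP[w0 wr].
  have dfw : derivable (fun w => f w * w^-1) w 1.
    apply: derivableM; first exact: df.
    by apply: derivableV => //; exact: derivable_id.
  apply: near_eq_derivable dfw.
  apply/nbhs_normcP; exists (N w); first by rewrite normc_gt0.
  move=> v vw; rewrite Ff//; apply/eqP => v0; move: vw.
  by rewrite v0 sub0r normcN ltxx.
have cF : {for 0, continuous F}.
  apply/continuous_normcP => e e0.
  have [d d0 dP] := kP _ (divr_gt0 e0 (ltr0Sn _ 1)).
  exists d => // w /dP; rewrite f0 !subr0 => h.
  have [->|w0] := eqVneq w 0; first by rewrite subrr normc0.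
  have Nw0 : 0 < N w by rewrite normc_gt0.
  have -> : F w - F 0 = (f w - k * w) / w.
    by rewrite Ff// /F eqxx mulrBl mulfK.
  rewrite normcM normcV ltr_pdivrMr// (le_lt_trans h)// ltr_pM2r//.
  by rewrite gtr_pMr// invf_lt1// ltr1n.
have key r : N z <= r -> r < r0 -> N (f z) * r <= B * N z.
  move=> zr' rr0; have r_gt0 : 0 < r by exact: lt_le_trans zr'.
  have := maximum_principle r_gt0 rr0 dF cF.
  move=> /(_ (B / r)) H; have : N (F z) <= B / r.
    apply: H => // w wr; rewrite Ff; last by rewrite -normc_gt0 wr.
    rewrite normcM normcV wr ler_pM2r ?invr_gt0//; apply: fB.
    by rewrite wr.
  rewrite Ff// normcM normcV ler_pdivlMr// mulrAC ler_pdivrMr//.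
rewrite leNgt; apply/negP => h.
have fz0 : 0 < N (f z).
  rewrite lt_def normc_ge0 andbT; apply/eqP => e; move: h.
  rewrite e mul0r; apply/negP; rewrite -leNgt mulr_ge0// ?normc_ge0//.
  by apply: le_trans (fB z zr); exact: normc_ge0.
pose q := B * N z / N (f z).
have qr : q < r0 by rewrite /q ltr_pdivrMr// [ltRHS]mulrC.
pose r := Num.max (N z) ((q + r0) / 2).
have := key r; rewrite le_max lexx => /(_ isT).
have -> : r < r0 by rewrite gt_max zr /=; move: q qr {r} => q qr; lra.
move=> /(_ isT); rewrite [leLHS]mulrC -ler_pdivlMr// -/q ge_max => /andP[_].
by move: q qr {r h} => q qr; lra.
Qed.

(** Schwarz's lemma for the Cayley transform (g - g 0) / (g + conj (g 0)), which
    maps the right half-plane to the unit disk.  This symmetric form contains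
    both Harnack inequalities. *)
Lemma harnack_Re g (r0 : R) : 0 < r0 -> (forall z, N z < r0 -> derivable g z 1) ->
  (forall z, N z < r0 -> 0 < complex.Re (g z)) ->
  forall z, N z < r0 ->
  `|complex.Re (g z) - complex.Re (g 0)| * r0 <=
     N z * (complex.Re (g z) + complex.Re (g 0)).
Proof.
move=> r00 dg g0 z zr.
pose x0 := complex.Re (g 0); have x00 : 0 < x0 by apply: g0; rewrite normc0.
pose b : C R := x0 -i* complex.Im (g 0).
pose phi w := (g w - g 0) / (g w + b).
have reb w : complex.Re (g w + b) = complex.Re (g w) + x0 by rewrite raddfD.
have den w : N w < r0 -> g w + b != 0.
  move=> wr; apply/eqP => /(congr1 (@complex.Re R)); rewrite reb /=.
  by apply/eqP; rewrite gt_eqF// addr_gt0// g0.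
have nle w : N w < r0 -> N (g w - g 0) <= N (g w + b).
  move=> /g0 gw; rewrite -(@ler_pXn2r _ 2)// ?nnegrE ?normc_ge0// !sqr_normcE.
  have : 0 <= complex.Re (g w) * x0 by rewrite mulr_ge0 ?ltW.
  rewrite /b /x0; case: (g w) (g 0) => [a1 a2] [b1 b2] /=.
  by lra.
have := @schwarz phi r0 1 r00 _ _ _ z zr.
have dphi w : N w < r0 -> derivable phi w 1.
  move=> wr; apply: derivableM.
    by apply: derivableB; [exact: dg|exact: derivable_cst].
  apply: derivableV; first exact: den.
  by apply: derivableD; [exact: dg|exact: derivable_cst].
move=> /(_ dphi); rewrite /phi subrr mul0r => /(_ erefl).
have phi1 w : N w < r0 -> N (phi w) <= 1.
  move=> wr; rewrite /phi normcM normcV ler_pdivrMr ?normc_gt0 ?den//.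
  by rewrite mul1r nle.
move=> /(_ phi1); rewrite mul1r normcM normcV mulrAC ler_pdivrMr ?normc_gt0 ?den//.
move=> h.
have gz := g0 z zr; set x := complex.Re (g z) in gz *.
have xx : 0 < x + x0 by rewrite addr_gt0.
have xx' := ltW xx; have r00' := ltW r00.
rewrite -(ler_pXn2r (n:=2))// ?nnegrE ?mulr_ge0 ?normc_ge0//.
have : (N (g z - g 0) * r0) ^+ 2 <= (N z * N (g z + b)) ^+ 2.
  by rewrite ler_pXn2r// ?nnegrE ?mulr_ge0 ?normc_ge0// ltW.
rewrite !exprMn !sqr_normcE !raddfB !raddfD /= -/x -/x0 -sqr_normcE => h2.
rewrite real_normK ?num_real//.
set y2 := (complex.Im (g z) - complex.Im (g 0)) ^+ 2 in h2.
have hn : N z ^+ 2 <= r0 ^+ 2.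
  by rewrite ler_pXn2r// ?nnegrE ?normc_ge0// ltW.
have : N z ^+ 2 * y2 <= y2 * r0 ^+ 2 by rewrite mulrC ler_wpM2l ?sqr_ge0.
by lra.
Qed.

End MaximumPrinciple.

(** * The principal logarithm on the right half-plane *)

Section Logarithm.
Context {R : realType}.
Implicit Types (z w p c : C R) (f g F G : C R -> C R) (x y r : R).

Notation N := (@normc R).

Definition clog z : C R := ln (N z) +i* atan (complex.Im z / complex.Re z).

Lemma clogK z : 0 < complex.Re z -> cexp (clog z) = z.
Proof.
move=> z0; have Nz : 0 < N z by exact: lt_le_trans (le_trans (ler_norm _) (ler_Re_normc z)).
rewrite /cexp /= lnK ?posrE//.
set t := complex.Im z / complex.Re z.
have ct : cos (atan t) != 0 by rewrite gt_eqF// cos_atan invr_gt0 sqrtr_gt0 ltr_pwDl// sqr_ge0.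
have st : sin (atan t) = t * cos (atan t) by rewrite -[t in t * _]atanK /tan mulfVK.
have cN : N z * cos (atan t) = complex.Re z.
  rewrite cos_atan; apply: (mulIf (x := Num.sqrt (1 + t ^+ 2))).
    by rewrite gt_eqF// sqrtr_gt0 ltr_pwDl// sqr_ge0.
  rewrite mulfVK; last by rewrite gt_eqF// sqrtr_gt0 ltr_pwDl// sqr_ge0.
  apply/eqP; rewrite -(@eqrXn2 _ 2)//; last 2 first.
  - exact: normc_ge0.
  - by rewrite mulr_ge0 ?sqrtr_ge0 ?ltW.
  rewrite exprMn sqr_sqrtr ?addr_ge0 ?sqr_ge0// sqr_normcE /t.
  by apply/eqP; field; rewrite gt_eqF.
rewrite st mulrCA cN /t mulfVK ?gt_eqF//.
by case: z {z0 Nz t ct st cN}.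
Qed.

Lemma Re_gt0_near1 z : N (z - 1) < 1 -> 0 < complex.Re z.
Proof.
move=> /(le_lt_trans (ler_Re_normc _)); rewrite raddfB /= ltr_norml; lra.
Qed.

Lemma continuous_clog z : 0 < complex.Re z -> {for z, continuous clog}.
Proof.
move=> z0; have Nz : 0 < N z by exact: lt_le_trans (le_trans (ler_norm _) (ler_Re_normc z)).
have h1 : {for z, continuous (fun w : C R => ln (N w))}.
  apply: continuous_comp; last exact: continuous_ln.
  by have := @continuous_normc_comp R id z; apply; exact: cvg_id.
have h2 : {for z, continuous (fun w : C R => atan (complex.Im w / complex.Re w))}.
  apply: continuous_comp; last exact: continuous_atan.
  apply: (continuousM (@continuous_Im R z)); apply: (@continuousV _ _ (@complex.Re R : C R -> R)).
    by rewrite gt_eqF.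
  exact: continuous_Re.
apply: (@continuous_comp _ _ _
  (fun w : C R => (ln (N w), atan (complex.Im w / complex.Re w)))
  (fun p : R * R => p.1 +i* p.2 : C R)).
  exact: cvg_pair h1 h2.
exact: continuous_Complex.
Qed.

(** [clog] is a continuous inverse of [cexp], whose derivative has no zeros. *)
Lemma derivable_clog z : 0 < complex.Re z -> derivable clog z 1.
Proof.
move=> z0; have Nz : 0 < N z by exact: lt_le_trans (le_trans (ler_norm _) (ler_Re_normc z)).
have zn0 : z != 0 by rewrite -normc_gt0.
apply/derivable_normcP; exists z^-1 => e e0.
pose e' := Num.min (N z / 2) (e * N z ^+ 2 / 2).
have e'0 : 0 < e' by rewrite /e' lt_min !divr_gt0// mulr_gt0// exprn_gt0.
have e'1 : e' <= N z / 2 by rewrite /e' ge_min lexx.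
have e'2 : e' <= e * N z ^+ 2 / 2 by rewrite /e' ge_min lexx orbT.
have [d d0 dP] := cexp_remainder (clog z) e'0.
have [d1 d10 d1P] := (continuous_normcP _ _).1 (continuous_clog z0) _ d0.
exists (Num.min d1 (complex.Re z)); first by rewrite lt_min d10.
move=> w; rewrite lt_min => /andP[/d1P wd wz].
have w0 : 0 < complex.Re w.
  move: wz => /(le_lt_trans (ler_Re_normc _)); rewrite raddfB /= ltr_norml; lra.
move: wd => /dP; rewrite !clogK//.
set s := clog w - clog z => h.
have h1 : N z * N s <= N (w - z) + e' * N s.
  rewrite -normcM.
  have -> : z * s = (w - z) - (w - z - z * s) by rewrite opprB addrC subrK.
  by rewrite (le_trans (ler_normcD _ _))// normcN lerD2l.
have s0 : 0 <= N s := normc_ge0 s.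
have h2 : N z * N s <= 2 * N (w - z).
  have : e' * N s <= N z / 2 * N s by rewrite ler_wpM2r.
  by lra.
have -> : s - z^-1 * (w - z) = - (z^-1 * (w - z - z * s)).
  by rewrite [in RHS]mulrBr opprB mulKf.
rewrite normcN normcM normcV mulrC ler_pdivrMr// (le_trans h)//.
have : e' * N s <= e * N z ^+ 2 / 2 * N s by rewrite ler_wpM2r.
have : e * N z / 2 * (N z * N s) <= e * N z / 2 * (2 * N (w - z)).
  by rewrite ler_wpM2l// divr_ge0// mulr_ge0// ltW.
by lra.
Qed.

End Logarithm.

(** * Logarithms of zero-free functions and Harnack's inequality for ln |f| *)

Section Harnack.
Context {R : realType}.
Implicit Types (z w p c : C R) (f g F G : C R -> C R) (x y r : R).

Notation N := (@normc R).

Lemma exists_small_fraction (r e : R) : 0 < r -> 0 < e ->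
  exists2 n : nat, 0 < n%:R :> R & r / n%:R < e.
Proof.
move=> r0 e0; have re0 : 0 < r / e by rewrite divr_gt0.
have h := archi_boundP (ltW re0); exists (Num.Def.archi_bound (r / e)).
  exact: lt_trans re0 h.
by rewrite ltr_pdivrMr ?(lt_trans re0 h)// mulrC -ltr_pdivrMr.
Qed.

Lemma derivable_shift f p z : derivable f (z + p) 1 ->
  derivable (fun w => f (w + p)) z 1.
Proof.
move=> df; have da : derivable (fun w : C R => w + p) z 1.
  by apply: derivableD; [exact: derivable_id|exact: derivable_cst].
exact: (@derivable_compC _ (fun w : C R => w + p) f z da df).
Qed.

(** Schwarz's lemma for f - f p, bounded by 2 B. *)
Lemma schwarz_lipschitz f p (r0 B : R) : 0 < r0 ->
  (forall z, N (z - p) < r0 -> derivable f z 1) ->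
  (forall z, N (z - p) < r0 -> N (f z) <= B) ->
  forall z, N (z - p) < r0 -> N (f z - f p) * r0 <= 2 * B * N (z - p).
Proof.
move=> r00 df fB z zr.
have fp : N (f p) <= B by apply: fB; rewrite subrr normc0.
pose g w := f (w + p) - f p.
have dg w : N w < r0 -> derivable g w 1.
  move=> wr; apply: derivableB; last exact: derivable_cst.
  by apply: derivable_shift; apply: df; rewrite addrK.
have g0 : g 0 = 0 by rewrite /g add0r subrr.
have gB w : N w < r0 -> N (g w) <= 2 * B.
  move=> wr; have := fB (w + p); rewrite addrK => /(_ wr) h.
  by rewrite (le_trans (ler_normcD _ _))// normcN; lra.
by have := schwarz r00 dg g0 gB zr; rewrite /g subrK.
Qed.

Lemma normcZ (t : R) z : 0 <= t -> N (t%:C * z) = t * N z.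
Proof. by move=> t0; rewrite normcM normcR ger0_norm. Qed.

(** By uniform continuity, f z / f 0 is the product of the ratios of the values
    of f at n consecutive points of the segment from 0 to z, all of them close
    to 1; their principal logarithms add up to a logarithm of f z / f 0. *)
Lemma disc_log f (r0 r : R) : 0 < r -> r < r0 ->
  (forall z, N z < r0 -> derivable f z 1) -> (forall z, N z < r0 -> f z != 0) ->
  exists L : C R -> C R, forall z, N z < r ->
    derivable L z 1 /\ cexp (L z) * f 0 = f z.
Proof.
move=> rgt0 rr0 df f0.
pose r1 := (r + r0) / 2.
have rr1 : r < r1 by rewrite /r1; lra.
have r1r0 : r1 < r0 by rewrite /r1; lra.
have cN z : N z < r0 -> {for z, continuous (fun w => N (f w))}.
  by move=> /df /derivable_continuous /continuous_normc_comp.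
have [b br bP] : exists2 p, N (p - 0) <= r1 &
    forall z, N (z - 0) <= r1 -> N (f z) <= N (f p).
  apply: disc_EVT; first by rewrite ltW// (lt_trans rgt0).
  by move=> z; rewrite subr0 => h; apply: cN; exact: le_lt_trans h _.
have [a ar aP] : exists2 p, N (p - 0) <= r &
    forall z, N (z - 0) <= r -> - N (f z) <= - N (f p).
  apply: disc_EVT; first exact: ltW.
  move=> z; rewrite subr0 => h; apply: continuousN; apply: cN.
  exact: le_lt_trans h _.
rewrite subr0 in ar.
have {}bP z : N z <= r1 -> N (f z) <= N (f b) by have := bP z; rewrite subr0.
have {}aP z : N z <= r -> N (f a) <= N (f z).
  by have := aP z; rewrite subr0 lerN2.
set m := N (f a) in aP; set B := N (f b) in bP.
have m0 : 0 < m by rewrite normc_gt0 f0// (le_lt_trans ar).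
have B0 : 0 < B by apply: lt_le_trans m0 _; apply: bP; rewrite (le_trans ar)// ltW.
clearbody m B.
pose d := r1 - r; have d0 : 0 < d by rewrite subr_gt0.
have lip z w : N z <= r -> N (w - z) < d -> N (f w - f z) * d <= 2 * B * N (w - z).
  move=> zr wz.
  have sub v : N (v - z) < d -> N v <= r1.
    move=> vz; have := ler_normcD (v - z) z; rewrite subrK.
    by move: vz; rewrite /d; lra.
  apply: schwarz_lipschitz => // v /sub vr; first by apply: df; exact: le_lt_trans vr _.
  exact: bP.
(* Consecutive points of the segment are closer than d, and f varies between
   them by less than its minimal modulus m. *)
have g0 : 0 < Num.min d (d * m / (2 * B)).
  by rewrite lt_min d0 divr_gt0// mulr_gt0.
have [n n0 n2] := exists_small_fraction rgt0 g0.
move: n2; rewrite lt_min => /andP[nd nm].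
pose q k z := f ((k%:R / n%:R)%:C * z).
have kn k : (k <= n)%N -> 0 <= (k%:R / n%:R : R) <= 1.
  by move=> kn; rewrite divr_ge0//= ler_pdivrMr// mul1r ler_nat.
have qr k z : (k <= n)%N -> N z <= r -> N ((k%:R / n%:R)%:C * z) <= r.
  move=> /kn /andP[k0 k1] zr; rewrite normcZ//; apply: le_trans zr.
  by rewrite ler_piMl// normc_ge0.
have q0 k z : (k <= n)%N -> N z <= r -> q k z != 0.
  by move=> kn' zr; apply: f0; apply: le_lt_trans (qr _ _ kn' zr) rr0.
have ratio k z : (k < n)%N -> N z <= r -> N (q k.+1 z / q k z - 1) < 1.
  move=> kn' zr; have qk0 := q0 k z (ltnW kn') zr.
  have -> : q k.+1 z / q k z - 1 = (q k.+1 z - q k z) / q k z.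
    by rewrite mulrBl divff.
  rewrite normcM normcV ltr_pdivrMr ?normc_gt0// mul1r.
  have kz := qr k z (ltnW kn') zr.
  have st : N ((k.+1%:R / n%:R)%:C * z - (k%:R / n%:R)%:C * z) <= r / n%:R.
    rewrite -mulrBl -rmorphB -mulrBl -natrB// subSnn mul1r normcZ ?invr_ge0//.
    by rewrite mulrC ler_wpM2r// invr_ge0.
  have := lip _ _ kz (le_lt_trans st nd); rewrite -/(q k.+1 z) -/(q k z) => h.
  apply: lt_le_trans (aP _ kz); rewrite -(ltr_pM2r d0) (le_lt_trans h)//.
  rewrite mulrC -ltr_pdivlMr ?mulr_gt0// [m * d]mulrC.
  exact: le_lt_trans st nm.
have dq k z : (k <= n)%N -> N z < r -> derivable (q k) z 1.
  move=> kn' zr.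
  apply: (@derivable_compC _ (fun w : C R => (k%:R / n%:R)%:C * w) f).
    by apply: derivableM; [exact: derivable_cst|exact: derivable_id].
  by apply: df; rewrite (le_lt_trans _ rr0)// qr// ltW.
have [L LP] : exists L : C R -> C R, forall z, N z < r ->
    derivable L z 1 /\ cexp (L z) * f 0 = q n z.
  have : (n <= n)%N by [].
  elim: {-2}n => [_|k IH kn'].
    exists (fun=> 0) => z zr; split; first exact: derivable_cst.
    by rewrite cexp0 mul1r /q mul0r rmorph0 mul0r.
  have [L LP] := IH (ltnW kn').
  exists (fun z => L z + clog (q k.+1 z / q k z)) => z zr.
  have [dL LE] := LP z zr; have zr' := ltW zr.
  have re0 := Re_gt0_near1 (ratio k z kn' zr').
  split.
    have dr : derivable (fun z => q k.+1 z / q k z) z 1.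
      apply: derivableM; first exact: dq.
      apply: derivableV; first exact: q0 (ltnW kn') zr'.
      exact: dq (ltnW kn') zr.
    have dc := @derivable_compC R _ clog z dr (derivable_clog re0).
    exact: (derivableD dL dc).
  rewrite cexpD clogK// mulrAC LE mulrC mulfVK//.
  exact: q0 (ltnW kn') zr'.
exists L => z /LP[dL ->]; split=> //.
by rewrite /q divff ?lt0r_neq0// mul1r.
Qed.

(** On a smaller disk of radius r, ln (b / |f|) + e is the positive real part of
    a constant minus a logarithm of f; then e tends to 0 and r to r0. *)
Lemma harnack0 f (r0 b : R) : 0 < r0 -> 0 < b ->
  (forall z, N z < r0 -> derivable f z 1) -> (forall z, N z < r0 -> f z != 0) ->
  (forall z, N z < r0 -> N (f z) <= b) ->
  forall z, N z < r0 ->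
  `|ln (b / N (f z)) - ln (b / N (f 0))| * r0 <=
     N z * (ln (b / N (f z)) + ln (b / N (f 0))).
Proof.
move=> r00 b0 df f0 fb z zr.
have fp w : N w < r0 -> 0 < N (f w) by move=> wr; rewrite normc_gt0 f0.
have z0 : N (0 : C R) < r0 by rewrite normc0.
have lnE w : N w < r0 -> ln (b / N (f w)) = ln b - ln (N (f w)).
  by move=> /fp wr; rewrite ln_div// posrE.
have key (e r : R) : 0 < e -> N z < r -> r < r0 ->
    `|ln (b / N (f z)) - ln (b / N (f 0))| * r <=
    N z * (ln (b / N (f z)) + ln (b / N (f 0)) + 2 * e).
  move=> e0 zr' rr0; have rgt0 : 0 < r by apply: le_lt_trans zr'; exact: normc_ge0.
  have [L LP] := disc_log rgt0 rr0 df f0.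
  pose k : C R := (ln b - ln (N (f 0)) + e)%:C.
  have ReL w : N w < r -> complex.Re (k - L w) = ln (b / N (f w)) + e.
    move=> wr; have wr0 := lt_trans wr rr0; rewrite lnE//.
    have [_ E] := LP w wr.
    have : ln (N (f w)) = complex.Re (L w) + ln (N (f 0)).
      rewrite -E normcM normc_cexp lnM ?posrE ?expR_gt0 ?fp//.
      by rewrite expRK.
    by move=> ->; rewrite raddfB /=; ring.
  have := @harnack_Re R (fun w => k - L w) r rgt0 _ _ z zr'.
  rewrite !ReL// ?normc0//.
  have -> : forall s t : R, s + e + (t + e) = s + t + 2 * e by move=> s t; ring.
  have -> : forall s t : R, s + e - (t + e) = s - t by move=> s t; ring.
  apply=> w wr.
    by apply: derivableB; [exact: derivable_cst|have [] := LP w wr].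
  rewrite ReL// ltr_pwDr//.
  have wr0 := lt_trans wr rr0.
  by rewrite ln_ge0// ler_pdivlMr ?fp// mul1r fb.
move: key; set A := `|_|; set B := _ + ln _ => key.
have A0 : 0 <= A by exact: normr_ge0.
have nz0 : 0 <= N z := normc_ge0 z.
clearbody A B; clear lnE fp.
apply/ler_addgt0Pr => e e0.
pose e1 := e / (4 * (N z + 1)).
have e10 : 0 < e1 by rewrite divr_gt0// mulr_gt0// ltr_wpDl.
have e1N : N z * (2 * e1) <= e / 2.
  have -> : N z * (2 * e1) = e / 2 * (N z / (N z + 1)).
    by rewrite /e1; field; rewrite gt_eqF// ltr_wpDl.
  rewrite ler_piMr//; first by rewrite divr_ge0// ltW.
  by rewrite ler_pdivrMr ?ltr_wpDl// mul1r lerDl.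
pose r := Num.max ((N z + r0) / 2) (r0 - e / (2 * (A + 1))).
have r1 : N z < r by rewrite lt_max; apply/orP; left; lra.
have r2 : r < r0.
  rewrite gt_max; apply/andP; split; first by lra.
  by rewrite gtrDl oppr_lt0 divr_gt0// mulr_gt0// ltr_wpDl.
have r3 : A * r0 <= A * r + e / 2.
  have : r0 - e / (2 * (A + 1)) <= r by rewrite /r le_max lexx orbT.
  move=> /(ler_wpM2l A0); rewrite mulrBr => h.
  have : A * (e / (2 * (A + 1))) <= e / 2.
    have -> : A * (e / (2 * (A + 1))) = e / 2 * (A / (A + 1)).
      by field; rewrite gt_eqF// ltr_wpDl.
    rewrite ler_piMr//; first by rewrite divr_ge0// ltW.
    by rewrite ler_pdivrMr ?ltr_wpDl// mul1r lerDl.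
  by move: h; set q := A * (e / _); move: q => q h1 h2; lra.
have := key _ _ e10 r1 r2; rewrite mulrDr => h.
by clear key; move: h r3 e1N; set q := N z * (2 * e1); move: q => q ? ? ?; lra.
Qed.

Lemma harnack f p (r0 b : R) : 0 < r0 -> 0 < b ->
  (forall z, N (z - p) < r0 -> derivable f z 1) ->
  (forall z, N (z - p) < r0 -> f z != 0) ->
  (forall z, N (z - p) < r0 -> N (f z) <= b) ->
  forall z, N (z - p) < r0 ->
  `|ln (b / N (f z)) - ln (b / N (f p))| * r0 <=
     N (z - p) * (ln (b / N (f z)) + ln (b / N (f p))).
Proof.
move=> r00 b0 df f0 fb z zr.
pose g w := f (w + p).
have dg w : N w < r0 -> derivable g w 1.
  by move=> wr; apply: derivable_shift; apply: df; rewrite addrK.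
have g0 w : N w < r0 -> g w != 0 by move=> wr; apply: f0; rewrite addrK.
have gb w : N w < r0 -> N (g w) <= b by move=> wr; apply: fb; rewrite addrK.
by have := harnack0 r00 b0 dg g0 gb zr; rewrite /g add0r subrK.
Qed.

End Harnack.

(** * Winding numbers *)

Section Loops.
Context {R : realType}.
Implicit Types (z w p c : C R) (x y r t : R) (q : R -> C R).

Notation N := (@normc R).

(** The closed curve q, of period T, has winding number 0 about the origin: up
    to the constant factor c it has a continuous argument a that returns to its
    initial value. *)
Definition loop_log T q := exists (a : R -> R) (c : C R),
  [/\ continuous a, a T = a 0 & forall t, exists x, q t = c * cexp (x +i* a t)].

Lemma loop_logM T q1 q2 : loop_log T q1 -> loop_log T q2 ->
  loop_log T (fun t => q1 t * q2 t).
Proof.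
move=> [a1 [c1 [ca1 a1T h1]]] [a2 [c2 [ca2 a2T h2]]].
exists (fun t => a1 t + a2 t), (c1 * c2); split.
- by move=> t; apply: cvgD; [exact: ca1|exact: ca2].
- by rewrite a1T a2T.
- move=> t; have [x1 ->] := h1 t; have [x2 ->] := h2 t.
  exists (x1 + x2); rewrite mulrACA -cexpD; congr (_ * cexp _).
Qed.

Lemma loop_logV T q : loop_log T q -> loop_log T (fun t => (q t)^-1).
Proof.
move=> [a [c [ca aT h]]]; exists (fun t => - a t), c^-1; split.
- by move=> t; apply: cvgN; exact: ca.
- by rewrite aT.
- move=> t; have [x ->] := h t; exists (- x).
  by rewrite invfM -cexpN.
Qed.

Lemma loop_log_near1 T q : continuous q -> q T = q 0 ->
  (forall t, N (q t - 1) < 1) -> loop_log T q.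
Proof.
move=> cq qT q1; exists (fun t => complex.Im (clog (q t))), 1; split.
- move=> t; have q0 := Re_gt0_near1 (q1 t).
  have c1 : {for t, continuous (fun t => clog (q t))}.
    by apply: continuous_comp; [exact: cq|exact: continuous_clog].
  apply: (@continuous_comp _ _ _ _ (@complex.Im R : C R -> R) _ c1).
  exact: continuous_Im.
- by rewrite qT.
- move=> t; exists (complex.Re (clog (q t))); rewrite mul1r.
  by rewrite -[LHS]clogK ?Re_gt0_near1//; congr cexp; case: (clog _).
Qed.

(** Homotopy invariance of the winding number, for a discretized homotopy Q. *)
Lemma loop_log_chain T n (Q : nat -> R -> C R) :
  (forall k, (k <= n)%N -> continuous (Q k)) ->
  (forall k, Q k T = Q k 0) -> (forall k t, (k <= n)%N -> Q k t != 0) ->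
  (forall k t, (k < n)%N -> N (Q k.+1 t - Q k t) < N (Q k t)) ->
  loop_log T (fun t => Q n t / Q 0%N t).
Proof.
move=> cQ QT; elim: n cQ => [|n IH] cQ Q0 Qn.
  exists (fun=> 0), 1; split=> //; first by move=> t; exact: cvg_cst.
  by move=> t; exists 0; rewrite divff ?Q0// cexp0 mulr1.
have near1 t : N (Q n.+1 t / Q n t - 1) < 1.
  have Qnt := Q0 n t (leqnSn n).
  have -> : Q n.+1 t / Q n t - 1 = (Q n.+1 t - Q n t) / Q n t.
    by rewrite mulrBl divff.
  by rewrite normcM normcV ltr_pdivrMr ?normc_gt0// mul1r Qn.
have l1 : loop_log T (fun t => Q n.+1 t / Q n t).
  apply: loop_log_near1 => //; last by rewrite !QT.
  move=> t; apply: (continuousM (cQ _ (leqnn _) t)).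
  by apply: continuousV; [exact: Q0|exact: cQ].
have l2 : loop_log T (fun t => Q n t / Q 0%N t).
  apply: IH => [k kn|k t kn|k t kn]; [apply: cQ|apply: Q0|apply: Qn].
  - exact: leq_trans kn (leqnSn _).
  - exact: leq_trans kn (leqnSn _).
  - exact: leq_trans kn (leqnSn _).
have -> : (fun t => Q n.+1 t / Q 0%N t) =
    (fun t => Q n.+1 t / Q n t * (Q n t / Q 0%N t)).
  by apply/funext => t; rewrite mulrA mulfVK// Q0.
exact: loop_logM.
Qed.

(** If a were a periodic argument, a t - t would go from a 0 to a 0 - 2 pi and
    take the value a 0 - pi on the way; but it is constant modulo 2 pi. *)
Lemma circle_no_loop_log (k : C R) : k != 0 ->
  ~ loop_log (pi *+ 2) (fun t => k * cexp (0 +i* t)).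
Proof.
move=> k0 [a [c [ca aT h]]].
have T0 : 0 <= pi *+ 2 :> R by rewrite mulrn_wge0// pi_ge0.
have := @IVT R (fun t => a t - t) 0 (pi *+ 2) (a 0 - pi) T0.
have cD : {within `[0, pi *+ 2], continuous (fun t => a t - t)}.
  apply: continuous_subspaceT => t.
  by apply: cvgB; [exact: ca|exact: cvg_id].
move=> /(_ cD); rewrite subr0 aT.
have pi0 := @pi_ge0 R.
have -> : Num.min (a 0) (a 0 - pi *+ 2) <= a 0 - pi <= Num.max (a 0) (a 0 - pi *+ 2).
  rewrite ge_min le_max; apply/andP; split; apply/orP; [right|left].
    by rewrite lerD2l lerN2 mulr2n lerDl.
  by rewrite gerDl oppr_le0.
move=> /(_ isT)[t _ E].
have [x0 h0] := h 0; have [x1 h1] := h t.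
have c0 : c != 0.
  by apply: contraNneq k0 => c0; move: h0; rewrite c0 mul0r cexp0 mulr1 => ->.
have : k = c * cexp (x1 +i* (a t - t)).
  have -> : x1 +i* (a t - t) = x1 +i* a t + - (0 +i* t) :> C R.
    by congr Complex; ring.
  by rewrite cexpD mulrA -h1 cexpN mulfK// cexp_neq0.
rewrite cexp0 mulr1 in h0; rewrite E h0 => /(mulfI c0) e.
have : cexp ((x0 - x1) +i* pi) = 1.
  have -> : (x0 - x1) +i* pi = (x0 +i* a 0) + - (x1 +i* (a 0 - pi)) :> C R.
    by congr Complex; ring.
  by rewrite cexpD cexpN e divff// cexp_neq0.
move=> /(congr1 (@complex.Re R)); rewrite /= cospi mulrN1 => /eqP.
by rewrite lt_eqF// (lt_trans _ ltr01)// oppr_lt0 expR_gt0.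
Qed.

End Loops.

(** * Countable closed covers of the plane *)

Section Baire.
Context {R : realType}.
Notation N := (@normc R).

(** Baire's theorem for the plane: otherwise there are nested squares, the n-th
    of which misses A n, and their common point is in no A n. *)
Lemma closed_cover_interior (A : nat -> set (C R)) : (forall n, closed (A n)) ->
  (forall z, exists n, A n z) ->
  exists (n : nat) (a : C R) (r : R), 0 < r /\ forall z, N (z - a) < r -> A n z.
Proof.
move=> clA cov; apply: contrapT => H.
have {}H n a r : 0 < r -> exists2 z, N (z - a) < r & ~ A n z.
  move=> r0; apply: contrapT => K; apply: H; exists n, a, r; split=> // z zr.
  by apply: contrapT => Az; apply: K; exists z.
(* A square is given by its lower left corner and its side. *)
have step (ns : nat * (R * R * R)) : exists s : R * R * R, 0 < ns.2.2 ->
    [/\ 0 < s.2, ns.2.1.1 <= s.1.1 /\ s.1.1 + s.2 <= ns.2.1.1 + ns.2.2,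
        ns.2.1.2 <= s.1.2 /\ s.1.2 + s.2 <= ns.2.1.2 + ns.2.2 &
        forall u v, s.1.1 <= u <= s.1.1 + s.2 -> s.1.2 <= v <= s.1.2 + s.2 ->
          ~ A ns.1 (u +i* v)].
  case: ns => n [[x y] s] /=.
  have [s0|s0] := ltP 0 s; last by exists (0, 0, 0).
  have [z zs Az] := H n ((x + s / 2) +i* (y + s / 2)) _ (divr_gt0 s0 (ltr0Sn _ 1)).
  have [d d0 dP] : exists2 d : R, 0 < d & forall w, N (w - z) < d -> ~ A n w.
    by apply/nbhs_normcP; apply: open_nbhs_nbhs; split=> //; exact: closed_openC.
  have := le_lt_trans (ler_Re_normc _) zs; have := le_lt_trans (ler_Im_normc _) zs.
  case: z {zs} Az dP => [z1 z2] /= Az dP; rewrite !ltr_norml => /andP[y1 y2] /andP[x1 x2].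
  pose s' := Num.min (d / 3) (Num.min (x + s - z1) (y + s - z2)).
  have s'0 : 0 < s' by rewrite !lt_min divr_gt0//; apply/andP; split; lra.
  have s'd : s' <= d / 3 by rewrite /s' ge_min lexx.
  have s'x : s' <= x + s - z1 by rewrite /s' !ge_min lexx orbT.
  have s'y : s' <= y + s - z2 by rewrite /s' !ge_min lexx !orbT.
  clearbody s'; exists (z1, z2, s') => _ /=; split=> //; [lra|lra|].
  move=> u v /andP[u1 u2] /andP[v1 v2]; apply: dP.
  have -> : (u +i* v) - (z1 +i* z2) = (u - z1) +i* (v - z2) :> C R by [].
  apply: le_lt_trans (normc_le_add _ _) _.
  by rewrite !ger0_norm ?subr_ge0//; lra.
have [F FP] := choice step.
pose S := fix S n := if n is m.+1 then F (m, S m) else (0, 0, 1 : R).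
have S0 n : 0 < (S n).2.
  by elim: n => [|n IH] //=; have [] := FP (n, S n) IH.
have SP n := FP (n, S n) (S0 n).
have [X Xn] : exists X, forall n, (S n).1.1 <= X <= (S n).1.1 + (S n).2.
  by apply: nested_segments => n; [rewrite ltW|have [_ []] := SP n|have [_ []] := SP n].
have [Y Yn] : exists Y, forall n, (S n).1.2 <= Y <= (S n).1.2 + (S n).2.
  by apply: nested_segments => n; [rewrite ltW|have [_ _ []] := SP n|have [_ _ []] := SP n].
have [n] := cov (X +i* Y); have [_ _ _] := SP n; apply.
  exact: (Xn n.+1).
exact: (Yn n.+1).
Qed.

End Baire.

(** * Holomorphic motions of the plane: distortion *)

Section Motion.
Context {R : realType}.
Implicit Types (z w p a l : C R) (r s b e t : R) (f : C R -> C R -> C R).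

Notation N := (@normc R).

(** The finite part of a holomorphic motion of the sphere fixing infinity:
    the orbit of z is [f z]. *)
Definition plane_motion f :=
  [/\ forall z l, N l < 1 -> derivable (f z) l 1,
      forall z w l, N l < 1 -> f z l = f w l -> z = w &
      forall z, f z 0 = z].

Definition orbit_le f r b z := forall l, N l < r -> N (f z l) <= b.

Lemma motion_diff f r b z w : plane_motion f -> r <= 1 -> z != w ->
  orbit_le f r b z -> orbit_le f r b w ->
  [/\ forall l, N l < r -> derivable (fun l => f z l - f w l) l 1,
      forall l, N l < r -> f z l - f w l != 0 &
      forall l, N l < r -> N (f z l - f w l) <= 2 * b].
Proof.
move=> [df inj f0] r1 zw bz bw; split=> l lr.
- by apply: derivableB; apply: df; exact: lt_le_trans lr r1.
- apply: contraNneq zw => /eqP; rewrite subr_eq0 => /eqP /inj -> //.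
  exact: lt_le_trans lr r1.
- by rewrite (le_trans (ler_normcD _ _))// normcN mulrDl mul1r lerD ?bz ?bw.
Qed.

(** Harnack's inequality for f z - f w about the time 0, when it is z - w. *)
Lemma motion_harnack f r b z w l : plane_motion f -> 0 < r -> r <= 1 -> 0 < b ->
  z != w -> orbit_le f r b z -> orbit_le f r b w -> N l < r ->
  [/\ 0 <= ln (2 * b / N (f z l - f w l)), 0 <= ln (2 * b / N (z - w)) &
  `|ln (2 * b / N (f z l - f w l)) - ln (2 * b / N (z - w))| * r <=
     N l * (ln (2 * b / N (f z l - f w l)) + ln (2 * b / N (z - w)))].
Proof.
move=> fm r0 r1 b0 zw bz bw lr.
have [d1 d2 d3] := motion_diff fm r1 zw bz bw.
have b20 : 0 < 2 * b by rewrite mulr_gt0.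
have [_ _ f0] := fm.
have pos m : N m < r -> 0 <= ln (2 * b / N (f z m - f w m)).
  move=> mr; rewrite ln_ge0// ler_pdivlMr ?normc_gt0 ?d2// mul1r.
  exact: d3.
have := pos 0; rewrite normc0 !f0 => /(_ r0) p0.
split=> //; first exact: pos.
by have := harnack0 r0 b20 d1 d2 d3 lr; rewrite !f0.
Qed.

Lemma ratio_bound (U V r s : R) : 0 <= r -> `|U - V| * r <= s * (U + V) ->
  (r - s) * U <= (r + s) * V /\ (r - s) * V <= (r + s) * U.
Proof.
move=> r0 h.
have : (U - V) * r <= `|U - V| * r by rewrite ler_wpM2r// ler_norm.
have : (V - U) * r <= `|U - V| * r by rewrite distrC ler_wpM2r// ler_norm.
by split; lra.
Qed.

(** The continuity part of the lambda-lemma: by Harnack's inequality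
    |f z l - f w l| is small when |z - w| is. *)
Lemma motion_equicontinuous f r b l e : plane_motion f -> 0 < r -> r <= 1 ->
  0 < b -> N l < r -> 0 < e ->
  exists2 d : R, 0 < d & forall z w, orbit_le f r b z -> orbit_le f r b w ->
    N (z - w) < d -> N (f z l - f w l) < e.
Proof.
move=> fm r0 r1 b0 lr e0; have b20 : 0 < 2 * b by rewrite mulr_gt0.
pose E := ln (2 * b / e); pose E' := (r + N l) / (r - N l) * E.
exists (2 * b * expR (- E')); first by rewrite mulr_gt0// expR_gt0.
move=> z w bz bw; have [->|zw] := eqVneq z w.
  by move=> _; rewrite subrr normc0.
have [_ d2 _] := motion_diff fm r1 zw bz bw.
have [U0 V0 h] := motion_harnack fm r0 r1 b0 zw bz bw lr.
have [_ {}h] := ratio_bound (ltW r0) h.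
have zw0 : 0 < N (z - w) by rewrite normc_gt0 subr_eq0.
have D0 : 0 < N (f z l - f w l) by rewrite normc_gt0 d2.
rewrite expRN ltr_pdivlMr ?expR_gt0// => H.
have {}H : E' < ln (2 * b / N (z - w)).
  rewrite -[E']expRK ltr_ln ?posrE ?expR_gt0 ?divr_gt0//.
  by rewrite ltr_pdivlMr// mulrC.
have : E < ln (2 * b / N (f z l - f w l)).
  have rl : 0 < r + N l by rewrite ltr_wpDr// normc_ge0.
  have rl' : 0 < r - N l by rewrite subr_gt0.
  rewrite -(ltr_pM2l rl); apply: lt_le_trans h.
  by move: H; rewrite -(ltr_pM2l rl') /E' mulrA mulrCA divff ?gt_eqF// mulr1.
rewrite /E ltr_ln ?posrE ?divr_gt0// ltr_pM2l//.
by rewrite ltf_pV2 ?posrE.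
Qed.

(** The other half of Harnack's inequality: points that are apart at time 0 stay
    apart. *)
Lemma motion_separated f r r' b s : plane_motion f -> 0 < r' -> r' < r ->
  r <= 1 -> 0 < b -> 0 < s ->
  exists2 c : R, 0 < c & forall z w l, orbit_le f r b z -> orbit_le f r b w ->
    s <= N (z - w) -> N l <= r' -> c <= N (f z l - f w l).
Proof.
move=> fm r'0 r'r r1 b0 s0; have b20 : 0 < 2 * b by rewrite mulr_gt0.
have r0 := lt_trans r'0 r'r.
pose E := (r + r') / (r - r') * ln (2 * b / s).
exists (2 * b * expR (- E)); first by rewrite mulr_gt0// expR_gt0.
move=> z w l bz bw szw lr'.
have zw0 : 0 < N (z - w) by exact: lt_le_trans szw.
have zw : z != w by rewrite -subr_eq0 -normc_gt0.
have lr := le_lt_trans lr' r'r.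
have [_ d2 _] := motion_diff fm r1 zw bz bw.
have [U0 V0 h] := motion_harnack fm r0 r1 b0 zw bz bw lr.
have {}h := le_trans h (ler_wpM2r (addr_ge0 U0 V0) lr').
have [{}h _] := ratio_bound (ltW r0) h.
have D0 : 0 < N (f z l - f w l) by rewrite normc_gt0 d2.
have rl' : 0 < r - r' by rewrite subr_gt0.
have VE : ln (2 * b / N (z - w)) <= ln (2 * b / s).
  by rewrite ler_ln ?posrE ?divr_gt0// ler_pM2l// lef_pV2 ?posrE.
have : ln (2 * b / N (f z l - f w l)) <= E.
  rewrite -(ler_pM2l rl') (le_trans h)// /E mulrA mulrCA divff ?gt_eqF// mulr1.
  by rewrite ler_pM2l// addr_gt0.
rewrite -ler_expR lnK ?posrE ?divr_gt0// => H.
by rewrite expRN ler_pdivrMr ?expR_gt0// -ler_pdivrMl// mulrC.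
Qed.

(** As the time runs from 0 to l, the curve w moves without meeting the orbit of
    p, so the winding number of w about p does not change.  Because of the
    uniform Lipschitz bound in time and the uniform distance from
    [motion_separated], finitely many intermediate times suffice. *)
Lemma motion_loop_log f r r' b (w : R -> C R) p s l T :
  plane_motion f -> 0 < r' -> r' < r -> r <= 1 -> 0 < b ->
  continuous w -> w T = w 0 -> orbit_le f r b p -> (forall t, orbit_le f r b (w t)) ->
  0 < s -> (forall t, s <= N (p - w t)) -> N l <= r' ->
  loop_log T (fun t => (f p l - f (w t) l) / (p - w t)).
Proof.
move=> fm r'0 r'r r1 b0 cw wT bp bw s0 sp lr'.
have [df inj f0] := fm.
have [c c0 cP] := motion_separated fm r'0 r'r r1 b0 s0.
have r0 := lt_trans r'0 r'r.
pose d := r - r'; have d0 : 0 < d by rewrite subr_gt0.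
have g0 : 0 < Num.min d (c * d / (4 * b)).
  by rewrite lt_min d0 divr_gt0// mulr_gt0.
have [n n0 n2] := exists_small_fraction r'0 g0.
move: n2; rewrite lt_min => /andP[nd nm].
pose u k : C R := (k%:R / n%:R)%:C * l.
have ur k : (k <= n)%N -> N (u k) <= r'.
  move=> kn; rewrite normcZ ?divr_ge0//; apply: le_trans lr'.
  by rewrite ler_piMl ?normc_ge0// ler_pdivrMr// mul1r ler_nat.
have us k : N (u k.+1 - u k) <= r' / n%:R.
  rewrite /u -mulrBl -rmorphB -mulrBl -natrB// subSnn mul1r normcZ ?invr_ge0 ?(ltW n0)//.
  by rewrite [leLHS]mulrC ler_wpM2r ?invr_ge0 ?(ltW n0).
have pw t : p != w t.
  by rewrite -subr_eq0 -normc_gt0; exact: lt_le_trans (sp t).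
pose Q k t := f p (u k) - f (w t) (u k).
have Qc k t : (k <= n)%N -> c <= N (Q k t).
  by move=> kn; apply: cP => //; exact: ur.
have un : u n = l by rewrite /u divff ?lt0r_neq0// mul1r.
have u0 : u 0%N = 0 by rewrite /u mul0r rmorph0 mul0r.
have <- : (fun t => Q n t / Q 0%N t) =
    (fun t => (f p l - f (w t) l) / (p - w t)).
  by apply/funext => t; rewrite /Q un u0 !f0.
apply: loop_log_chain.
- move=> k kn t; apply/(@cvg_normcP _ _ (nbhs t)) => e e0.
  have [e1 e10 eP] := motion_equicontinuous fm r0 r1 b0 (le_lt_trans (ur _ kn) r'r) e0.
  have cwt := (@cvg_normcP _ _ _ (nbhs_filter t) w (w t)).1 (cw t) e1 e10.
  near=> v.
  have vt : N (w v - w t) < e1 by near: v.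
  rewrite /Q.
  have -> : f p (u k) - f (w v) (u k) - (f p (u k) - f (w t) (u k)) =
    f (w t) (u k) - f (w v) (u k) by ring.
  by apply: eP => //; rewrite normc_distC.
- by move=> k; rewrite /Q wT.
- by move=> k t kn; rewrite -normc_gt0; exact: lt_le_trans (Qc _ _ kn).
- move=> k t kn; apply: lt_le_trans (Qc _ _ (ltnW kn)).
  have [d1 d2 d3] := motion_diff fm r1 (pw t) bp (bw t).
  have sub v : N (v - u k) < d -> N v < r.
    move=> vz; have := ler_normcD (v - u k) (u k); rewrite subrK.
    by have := ur k (ltnW kn); move: vz; rewrite /d; lra.
  have := @schwarz_lipschitz R (fun l => f p l - f (w t) l) (u k) d (2 * b) d0.
  move=> /(_ (fun v h => d1 v (sub v h)) (fun v h => d3 v (sub v h))).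
  move=> /(_ _ (le_lt_trans (us k) nd)) h.
  rewrite -(ltr_pM2r d0) (le_lt_trans h)//.
  rewrite (_ : 2 * (2 * b) = 4 * b); last by ring.
  by rewrite mulrC -ltr_pdivlMr ?mulr_gt0// (le_lt_trans (us k)).
Unshelve. all: by end_near. Qed.

End Motion.

(** * Holomorphic motions of the plane: local boundedness *)

Section Bound.
Context {R : realType}.
Implicit Types (z w p a l : C R) (r s b e t : R) (f : C R -> C R -> C R).

Notation N := (@normc R).

Lemma orbit_le_weak f r r' b b' z : r' <= r -> b <= b' ->
  orbit_le f r b z -> orbit_le f r' b' z.
Proof. by move=> rr bb h l lr; rewrite (le_trans _ bb)// h// (lt_le_trans lr). Qed.

Lemma orbit_bounded f r z : plane_motion f -> 0 < r -> r < 1 ->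
  exists2 b : R, 0 < b & orbit_le f r b z.
Proof.
move=> [df _ _] r0 r1.
have [p pr pP] : exists2 p, N (p - 0) <= r &
    forall l, N (l - 0) <= r -> N (f z l) <= N (f z p).
  apply: disc_EVT => [|l]; first exact: ltW.
  rewrite subr0 => lr; apply/continuous_normc_comp/derivable_continuous/df.
  exact: le_lt_trans r1.
exists (N (f z p) + 1); first by rewrite ltr_wpDl// normc_ge0.
move=> l lr; have := pP l; rewrite subr0 => /(_ (ltW lr)) h.
by rewrite (le_trans h)// lerDl.
Qed.

(** If z is close to a point w whose orbit is bounded by b, then f z l is close
    to f w l.  The equicontinuity estimate applies because the orbit of z has
    some bound, if perhaps a larger one. *)
Lemma closed_orbit_le f r b : plane_motion f -> 0 < r -> r < 1 -> 0 < b ->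
  closed (orbit_le f r b).
Proof.
move=> fm r0 r1 b0; rewrite -[X in closed X]setCK; apply: open_closedC.
rewrite openE => z /= zb.
have [l lr lb] : exists2 l, N l < r & b < N (f z l).
  apply: contrapT => h; apply: zb => l lr; rewrite leNgt; apply/negP => H.
  by apply: h; exists l.
have [m m0 mz] := orbit_bounded z fm r0 r1.
have M0 : 0 < Num.max b m by rewrite lt_max b0.
have g0 : 0 < N (f z l) - b by rewrite subr_gt0.
have [d d0 dP] := motion_equicontinuous fm r0 (ltW r1) M0 lr g0.
apply/nbhs_normcP; exists d => // w wz wb.
have := dP z w; rewrite normc_distC => /(_ _ _ wz) h.
have {}h : N (f z l - f w l) < N (f z l) - b.
  apply: h; first by apply: orbit_le_weak mz => //; rewrite le_max lexx orbT.
  by apply: orbit_le_weak wb => //; rewrite le_max lexx.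
have := ler_normcD (f z l - f w l) (f w l); rewrite subrK.
by have := wb l lr; move: h; move: (N _) (N _) (N _) => x y t; lra.
Qed.

Lemma continuous_circle a (s : R) : continuous (fun t : R => a + s%:C * cexp (0 +i* t)).
Proof.
move=> t; have c1 : {for t, continuous (fun t : R => (0 +i* t : C R))}.
  apply/(@cvg_normcP _ _ _ (nbhs_filter t)) => e e0.
  apply/nbhs_ballP; exists e => // u; rewrite /ball /= => tu.
  by rewrite subrr (expr0n _ 2) /= add0r sqrtr_sqr distrC.
have c2 : {for (0 +i* t : C R), continuous (fun z : C R => a + s%:C * cexp z)}.
  apply/derivable_continuous; apply: derivableD; first exact: derivable_cst.
  apply: derivableM; first exact: derivable_cst; exact: derivable_cexp.
exact: (continuous_comp c1 c2).
Qed.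

(** If some disc moves boundedly, the points outside it stay away from the
    motion of its centre: otherwise a moving circle about the centre
    would have the same winding number, 1, about such a point as about the
    centre, although it is 0 at time 0. *)
Lemma outside_separated f r r' b a s : plane_motion f -> 0 < r' -> r' < r ->
  r < 1 -> 0 < b -> 0 < s -> (forall w, N (w - a) < s -> orbit_le f r b w) ->
  exists2 c : R, 0 < c & forall z l, s <= N (z - a) -> N l <= r' ->
    c <= N (f z l - f a l).
Proof.
move=> fm r'0 r'r r1 b0 s0 ball_b.
have r0 := lt_trans r'0 r'r.
(* A circle inside the disk, at positive distance from the points outside. *)
pose q := s / 2; have q0 : 0 < q by rewrite divr_gt0.
pose w t : C R := a + q%:C * cexp (0 +i* t).
have wa t : N (w t - a) = q.
  by rewrite /w addrAC subrr add0r normcZ ?ltW// normc_cexp expR0 mulr1.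
have wT : w (pi *+ 2) = w 0.
  by rewrite /w /cexp /= cos2pi sin2pi cos0 sin0.
have qs : q < s by rewrite /q; lra.
have bw t : orbit_le f r b (w t) by apply: ball_b; rewrite wa.
have ba : orbit_le f r b a by apply: ball_b; rewrite subrr normc0.
have [c c0 cP] := motion_separated fm r'0 r'r (ltW r1) b0 q0.
exists c => // z l sz lr'; rewrite leNgt; apply/negP => zc.
have [bz' bz'0 bzP] := orbit_bounded z fm r0 r1.
pose M := Num.max b bz'; have M0 : 0 < M by rewrite lt_max b0.
have bM : b <= M by rewrite /M le_max lexx.
have zM : orbit_le f r M z by apply: orbit_le_weak bzP => //; rewrite /M le_max lexx orbT.
have wM t : orbit_le f r M (w t) by apply: orbit_le_weak (bw t).
have aM : orbit_le f r M a by apply: orbit_le_weak ba.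
have cw : continuous w by exact: continuous_circle.
have za : z - a != 0 by rewrite -normc_gt0; exact: lt_le_trans sz.
have zw t : q <= N (z - w t).
  have := ler_normcD (z - w t) (w t - a); rewrite wa addrA subrK.
  by move: sz; rewrite /q; move: (N _) (N _) => x y; lra.
have aw t : q <= N (a - w t) by rewrite normc_distC wa.
have lz := motion_loop_log fm r'0 r'r (ltW r1) M0 cw wT zM wM q0 zw lr'.
have la := motion_loop_log fm r'0 r'r (ltW r1) M0 cw wT aM wM q0 aw lr'.
have ne p t : q <= N (p - w t) -> p - w t != 0.
  by move=> h; rewrite -normc_gt0; exact: lt_le_trans h.
have lr := le_lt_trans lr' r'r.
have nef p t : orbit_le f r M p -> q <= N (p - w t) -> f p l - f (w t) l != 0.
  move=> pM /ne; rewrite subr_eq0 => pw.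
  by have [_ h _] := motion_diff fm (ltW r1) pw pM (wM t); exact: h.
have cf p : orbit_le f r M p -> continuous (fun t => f p l - f (w t) l).
  move=> pM t; apply/(@cvg_normcP _ _ _ (nbhs_filter t)) => e e0.
  have [e1 e10 eP] := motion_equicontinuous fm r0 (ltW r1) M0 lr e0.
  have cwt := (@cvg_normcP _ _ _ (nbhs_filter t) w (w t)).1 (cw t) e1 e10.
  near=> v; have vt : N (w v - w t) < e1 by near: v.
  have -> : f p l - f (w v) l - (f p l - f (w t) l) = f (w t) l - f (w v) l by ring.
  by apply: eP => //; rewrite normc_distC.
have ratio_l : loop_log (pi *+ 2) (fun t =>
    (f z l - f (w t) l) / (f a l - f (w t) l)).
  apply: loop_log_near1 => [t||t].
  - apply: (continuousM (cf z zM t)).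
    apply: (@continuousV _ _ (fun t => f a l - f (w t) l)); last exact: cf.
    exact: nef.
  - by rewrite wT.
  - have n1 := nef a t aM (aw t).
    have -> : (f z l - f (w t) l) / (f a l - f (w t) l) - 1 =
        (f z l - f a l) / (f a l - f (w t) l).
      rewrite -[X in _ - X](divff n1) -mulrBl; congr (_ / _); ring.
    rewrite normcM normcV ltr_pdivrMr ?normc_gt0// mul1r.
    by apply: lt_le_trans zc _; apply: cP.
have ratio_0 : loop_log (pi *+ 2) (fun t => (z - w t) / (z - a)).
  have czw t : {for t, continuous (fun t => z - w t)}.
    apply/(@cvg_normcP _ _ _ (nbhs_filter t)) => e e0.
    have cwt := (@cvg_normcP _ _ _ (nbhs_filter t) w (w t)).1 (cw t) e e0.
    near=> v; have vt : N (w v - w t) < e by near: v.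
    have -> : z - w v - (z - w t) = w t - w v by ring.
    by rewrite normc_distC.
  apply: loop_log_near1 => [t||t].
  - exact: (continuousM (czw t) (@cvg_cst _ _ _ _ _)).
  - by rewrite wT.
  - have -> : (z - w t) / (z - a) - 1 = (a - w t) / (z - a).
      rewrite -[X in _ - X](divff za) -mulrBl; congr (_ / _); ring.
    rewrite normcM normcV ltr_pdivrMr ?normc_gt0// mul1r normc_distC wa.
    exact: lt_le_trans qs sz.
(* Combining the four curves leaves (a - w t) / (z - a), a circle about 0. *)
apply: (@circle_no_loop_log R ((- q)%:C / (z - a))).
  rewrite mulf_neq0 ?invr_eq0// -normc_gt0 normcR normrN normr_gt0.
  by rewrite gt_eqF.
have := loop_logM ratio_0 (loop_logM lz (loop_logV (loop_logM ratio_l la))).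
congr loop_log; apply/funext => t.
have e1 := nef z t zM (zw t); have e2 := nef a t aM (aw t).
have e3 := ne z t (zw t); have e4 := ne a t (aw t).
have -> : (- q)%:C / (z - a) * cexp (0 +i* t) = (a - w t) / (z - a).
  have -> : a - w t = (- q)%:C * cexp (0 +i* t) by rewrite /w rmorphN; ring.
  by rewrite [LHS]mulrAC.
by field; rewrite za e1 e2 e3 e4.
Unshelve. all: by end_near. Qed.

(** The complement of a disk whose points have bounded orbits is treated by
    inversion about the orbit of the centre. *)
Lemma motion_bounded f r M : plane_motion f -> 0 < r -> r < 1 ->
  exists2 b : R, 0 < b & forall z, N z <= M -> orbit_le f r b z.
Proof.
move=> fm r0 r1.
have [df inj f0] := fm.
(* Every use of Harnack's inequality shrinks the time disk a little. *)
pose r2 := (r + 1) / 2; pose r' := (r + r2) / 2.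
have r2_1 : r2 < 1 by rewrite /r2; lra.
have r'r2 : r' < r2 by rewrite /r' /r2; lra.
have rr' : r < r' by rewrite /r' /r2; lra.
have r'0 := lt_trans r0 rr'; have r20 := lt_trans r'0 r'r2.
clearbody r2 r'.
have [n [a [s [s0 nP]]]] : exists (n : nat) (a : C R) (s : R),
    0 < s /\ forall z, N (z - a) < s -> orbit_le f r2 n.+1%:R z.
  apply: (@closed_cover_interior R (fun n => orbit_le f r2 n.+1%:R)) => [n|z].
    exact: closed_orbit_le.
  have [b b0 bz] := orbit_bounded z fm r20 r2_1.
  exists (Num.Def.archi_bound b); apply: orbit_le_weak bz => //.
  have := archi_boundP (ltW b0) => /ltW /le_trans; apply.
  by rewrite ler_nat.
have n0 : 0 < n.+1%:R :> R by rewrite ltr0n.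
have [c c0 cP] := outside_separated fm r'0 r'r2 r2_1 n0 s0 nP.
have ba : orbit_le f r2 n.+1%:R a by apply: nP; rewrite subrr normc0.
pose K := (r' + r) / (r' - r) * ln (Num.max (Num.max s (M + N a)) c / c).
exists (n.+1%:R + c * expR K).
  by rewrite addr_gt0// mulr_gt0// expR_gt0.
move=> z zM l lr; have lr2 := lt_trans lr (lt_trans rr' r'r2).
have [zs|zs] := ltP (N (z - a)) s.
  apply: le_trans (nP z zs l lr2) _.
  by rewrite lerDl mulr_ge0 ?expR_ge0// ltW.
have za : z != a.
  by rewrite -subr_eq0 -normc_gt0; exact: lt_le_trans zs.
pose g l := (f z l - f a l)^-1.
have ne m : N m < r' -> f z m - f a m != 0.
  by move=> /ltW mr; rewrite -normc_gt0; exact: lt_le_trans (cP _ _ zs mr).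
have dg m : N m < r' -> derivable g m 1.
  move=> mr; apply: derivableV; first exact: ne.
  by apply: derivableB; apply: df; rewrite (lt_trans mr)// (lt_trans r'r2).
have g0 m : N m < r' -> g m != 0 by move=> mr; rewrite invr_eq0 ne.
have gb m : N m < r' -> N (g m) <= c^-1.
  move=> mr; rewrite /g normcV lef_pV2 ?posrE ?normc_gt0 ?ne//.
  by apply: cP => //; exact: ltW.
have ci : 0 < c^-1 by rewrite invr_gt0.
have lr' := lt_trans lr rr'.
have h := harnack0 r'0 ci dg g0 gb lr'.
have D0 : 0 < N (f z l - f a l) by rewrite normc_gt0 ne.
have E0 : 0 < N (z - a) by rewrite normc_gt0 subr_eq0.
have gE m : c^-1 / N (g m) = N (f z m - f a m) / c.
  by rewrite /g normcV invrK mulrC.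
rewrite !gE !f0 in h.
have U0 : 0 <= ln (N (f z l - f a l) / c).
  by rewrite ln_ge0// ler_pdivlMr// mul1r cP// ltW.
have V0 : 0 <= ln (N (z - a) / c).
  rewrite ln_ge0// ler_pdivlMr// mul1r -[z]f0 -[a in X in _ <= X]f0 cP// ?f0//.
  by rewrite normc0 ltW.
have {}h := le_trans h (ler_wpM2r (addr_ge0 U0 V0) (ltW lr)).
have [{}h _] := ratio_bound (ltW r'0) h.
have rr : 0 < r' - r by rewrite subr_gt0.
have UK : ln (N (f z l - f a l) / c) <= K.
  rewrite -(ler_pM2l rr) (le_trans h)// /K mulrA mulrCA divff ?gt_eqF// mulr1.
  rewrite ler_pM2l ?addr_gt0// ler_ln ?posrE ?divr_gt0//; last first.
    by rewrite lt_max c0 orbT.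
  rewrite ler_pM2r// le_max le_max; apply/orP; left; apply/orP; right.
  by rewrite (le_trans (ler_normcD _ _))// normcN lerD2r.
have {UK} : N (f z l - f a l) <= c * expR K.
  by move: UK; rewrite -ler_expR lnK ?posrE ?divr_gt0// ler_pdivrMr// mulrC.
move=> UK; have := ler_normcD (f z l - f a l) (f a l); rewrite subrK => hh.
by apply: le_trans hh _; rewrite addrC lerD// ba.
Qed.

End Bound.

(** * Logarithmic energy *)

Local Open Scope ereal_scope.

(** Unlike linearity for integrable functions, this covers the case where the
    integral of phi is infinite, that is, measures of infinite energy. *)
Lemma integral_cst_sub d (T : measurableType d) (R : realType)
    (mu : probability T R) (phi : T -> \bar R) (m : R) :
  measurable_fun setT phi -> (forall x, 0 <= phi x) -> (0 <= m)%R ->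
  \int[mu]_x (m%:E - phi x) = m%:E - \int[mu]_x phi x.
Proof.
move=> mphi phi0 m0.
pose g x := m%:E - phi x.
have mg : measurable_fun setT g by apply: emeasurable_funB.
have mgp : measurable_fun setT g^\+ by exact: measurable_funepos.
have mgn : measurable_fun setT g^\- by exact: measurable_funeneg.
(* The identity m + g^- = phi + g^+ involves no infinite differences. *)
have E x : m%:E + g^\- x = phi x + g^\+ x.
  rewrite funeposE funenegE /g; have := phi0 x; case: (phi x) => [r| |]//= _.
    have -> : maxe (- (m - r))%:E 0 = (Num.max (r - m) 0)%:E.
      by rewrite EFin_max opprB.
    have -> : maxe (m%:E + (- r)%:E) 0 = (Num.max (m - r) 0)%:E.
      by rewrite EFin_max.
    rewrite -!EFinD; congr EFin.
    by have [rm|/ltW rm] := leP r m;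
      [rewrite (max_idPr _) ?subr_le0// (max_idPl _) ?subr_ge0//; ring|
       rewrite (max_idPl _) ?subr_ge0// (max_idPr _) ?subr_le0//; ring].
  by rewrite maxye maxNye adde0 addey.
have p1 : \int[mu]_x (m%:E + g^\- x) = m%:E + \int[mu]_x g^\- x.
  rewrite ge0_integralD//=.
  by rewrite integral_cst//= probability_setT mule1.
have p2 : \int[mu]_x (phi x + g^\+ x) = \int[mu]_x phi x + \int[mu]_x g^\+ x.
  by rewrite ge0_integralD.
have p3 : m%:E + \int[mu]_x g^\- x = \int[mu]_x phi x + \int[mu]_x g^\+ x.
  by rewrite -p1 -p2; apply: eq_integral => x _; exact: E.
have gp0 : 0 <= \int[mu]_x g^\+ x by apply: integral_ge0.
have gn0 : 0 <= \int[mu]_x g^\- x by apply: integral_ge0.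
have ph0 : 0 <= \int[mu]_x phi x by apply: integral_ge0.
have gpm : \int[mu]_x g^\+ x <= m%:E.
  have -> : m%:E = \int[mu]_x m%:E by rewrite integral_cst//= probability_setT mule1.
  apply: ge0_le_integral => //= x _.
  rewrite funeposE /g; have := phi0 x; case: (phi x) => [r| |]//= r0.
    have -> : maxe (m%:E + (- r)%:E) 0 = (Num.max (m - r) 0)%:E.
      by rewrite EFin_max.
    by rewrite !lee_fin in r0 *; rewrite ge_max m0 andbT lerBlDr lerDl.
  by rewrite addeNy maxNye lee_fin.
rewrite integralE -/g; move: p3 gp0 gn0 ph0 gpm.
move: (\int[mu]_x g^\+ x) (\int[mu]_x g^\- x) (\int[mu]_x phi x).
case=> [a| |] [b| |] [c| |]//=; rewrite -?EFinD => -[] p3 *.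
have e : (a - b = m - c)%R by lra.
exact: (congr1 EFin e).
Qed.

Lemma integral_supported d (T : measurableType d) (R : realType)
    (mu : probability T R) (K : set T) (f : T -> \bar R) :
  measurable K -> mu (~` K) = 0 -> measurable_fun setT f ->
  \int[mu]_x f x = \int[mu]_(x in K) f x.
Proof.
move=> mK muK mf; have mKc := measurableC mK.
rewrite -(setUv K) integral_setU ?setUv//; last first.
  by apply/disj_setPS => x [].
rewrite [X in _ + X](_ : _ = 0) ?adde0//.
rewrite (@ae_eq_integral _ _ _ mu (~` K) (cst 0) f)//.
- by rewrite integral0.
- exact: measurable_funTS.
- by exists (~` K); split=> // x /=; tauto.
Qed.

Local Close Scope ereal_scope.

Section Energy.
Context {R : realType}.
Local Notation N := (@normc R).
Local Notation B := (borelC R).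

Lemma measurable_open (U : set (C R)) : open U -> measurable (U : set B).
Proof. exact: sub_sigma_algebra. Qed.

Lemma measurable_closed (U : set (C R)) : closed U -> measurable (U : set B).
Proof.
move=> cU; have := measurableC (measurable_open (closed_openC cU)).
by rewrite setCK.
Qed.

Lemma measurable_continuousR (f : C R -> R) : continuous f ->
  measurable_fun setT (f : B -> R).
Proof.
move=> cf; apply: (measurability _ (RGenOInfty.measurableE R)) => //.
move=> _ [_ [x ->] <-]; rewrite setTI; apply: measurable_open.
by apply: open_comp => [y _|]; [exact: cf|rewrite set_itvE; exact: open_gt].
Qed.

Definition logdist (p : B * B) : \bar R := lne (N ((p.1 : C R) - (p.2 : C R)))%:E.

Lemma measurable_logdist : measurable_fun setT logdist.
Proof.
have mRe : measurable_fun setT (@complex.Re R : B -> R).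
  by apply: measurable_continuousR => z; exact: continuous_Re.
have mIm : measurable_fun setT (@complex.Im R : B -> R).
  by apply: measurable_continuousR => z; exact: continuous_Im.
have mN : measurable_fun setT (fun p : B * B => N ((p.1 : C R) - (p.2 : C R))).
  have -> : (fun p : B * B => N ((p.1 : C R) - (p.2 : C R))) =
     (fun p => Num.sqrt ((complex.Re (p.1 : C R) - complex.Re (p.2 : C R)) ^+ 2 +
       (complex.Im (p.1 : C R) - complex.Im (p.2 : C R)) ^+ 2)).
    by apply/funext => -[[a b] [c d]].
  apply: (measurableT_comp (continuous_measurable_fun (@sqrt_continuous R))).
  apply: measurable_funD; apply: measurable_funX; apply: measurable_funB.
  - exact: (measurableT_comp mRe measurable_fst).
  - exact: (measurableT_comp mRe measurable_snd).
  - exact: (measurableT_comp mIm measurable_fst).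
  - exact: (measurableT_comp mIm measurable_snd).
rewrite /logdist /lne; apply: measurable_fun_ifT => //.
  by apply: measurable_fun_ler => //; exact: measurable_cst.
apply/measurable_EFinP; apply: (measurableT_comp (@measurable_ln R)) => //.
Qed.

(** The kernel ln (b / |z - w|), truncated at 0 for |z - w| > b so that it is
    nonnegative everywhere and Tonelli's theorem applies. *)
Definition kernel_log (b : R) (p : B * B) : \bar R :=
  (maxe 0 ((ln b)%:E - logdist p))%E.

Lemma measurable_kernel_log b : measurable_fun setT (kernel_log b).
Proof.
apply: measurable_maxe; first exact: measurable_cst.
by apply: emeasurable_funB; [exact: measurable_cst|exact: measurable_logdist].
Qed.

Lemma kernel_log_ge0 b p : (0 <= kernel_log b p)%E.
Proof. by rewrite /kernel_log le_max lexx. Qed.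

Lemma kernel_log_diag b (z : C R) : kernel_log b (z, z) = +oo%E.
Proof. by rewrite /kernel_log /logdist subrr normc0 /lne lexx /= maxey. Qed.

Lemma kernel_logE b (z w : C R) : 0 < b -> z != w -> (N (z - w) <= b)%R ->
  kernel_log b (z, w) = (ln (b / N (z - w)))%:E /\
  logdist (z, w) = ((ln b)%:E - kernel_log b (z, w))%E.
Proof.
move=> b0 zw zwb; have D0 : (0 < N (z - w))%R by rewrite normc_gt0 subr_eq0.
have E : logdist (z, w) = (ln (N (z - w)))%:E.
  by rewrite /logdist /lne /= leNgt D0.
have -> : kernel_log b (z, w) = (ln (b / N (z - w)))%:E.
  rewrite /kernel_log E -EFinB ln_div ?posrE//; apply/max_idPr.
  by rewrite lee_fin subr_ge0 ler_ln ?posrE.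
split=> //; rewrite E ln_div ?posrE// -EFinB; congr EFin; ring.
Qed.

Lemma logdistE b (z w : C R) : 0 < b -> (N (z - w) <= b)%R ->
  logdist (z, w) = ((ln b)%:E - kernel_log b (z, w))%E.
Proof.
move=> b0 zwb; have [->|zw] := eqVneq z w; last by have [] := kernel_logE b0 zw zwb.
by rewrite kernel_log_diag /logdist subrr normc0 /lne lexx.
Qed.

Lemma log_energyE (K : set (C R)) (mu : probability B R) (b : R) : closed K ->
  1 <= b -> (forall z w, K z -> K w -> (N (z - w) <= b)%R) ->
  supported_on K mu ->
  log_energy mu = (\int[mu]_w \int[mu]_z kernel_log b (z, w) - (ln b)%:E)%E.
Proof.
move=> clK b1 Kb muK; have mK := measurable_closed clK.
have b0 : 0 < b by exact: lt_le_trans b1.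
have lb0 : (0 <= ln b)%R by exact: ln_ge0.
have ml w : measurable_fun setT (fun z => logdist (z, w)).
  exact: measurable_fun_pair1 measurable_logdist.
have mk w : measurable_fun setT (fun z => kernel_log b (z, w)).
  exact: measurable_fun_pair1 (measurable_kernel_log b).
have mG : measurable_fun setT (fun w => \int[mu]_z logdist (z, w))%E.
  rewrite (_ : (fun w => _) =
      (fun w => fubini_G mu logdist^\+ w - fubini_G mu logdist^\- w)%E); last first.
    apply/funext => w; rewrite integralE /fubini_G; congr (_ - _)%E.
      by apply: eq_integral => z _; rewrite !funeposE.
    by apply: eq_integral => z _; rewrite !funenegE.
  apply: emeasurable_funB; apply: measurable_fun_fubini_tonelli_G => //.
    exact: measurable_funepos measurable_logdist.
  exact: measurable_funeneg measurable_logdist.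
have mH : measurable_fun setT (fun w => \int[mu]_z kernel_log b (z, w))%E.
  apply: (@measurable_fun_fubini_tonelli_G _ _ _ _ _ mu (kernel_log b)).
    exact: measurable_kernel_log.
  exact: kernel_log_ge0.
have H0 w : (0 <= \int[mu]_z kernel_log b (z, w))%E.
  by apply: integral_ge0 => z _; exact: kernel_log_ge0.
rewrite /log_energy.
have -> : (\int[mu]_w \int[mu]_z lne (N ((z : C R) - (w : C R))%R)%:E =
    \int[mu]_w ((ln b)%:E - \int[mu]_z kernel_log b (z, w)))%E.
  rewrite (integral_supported mK muK mG) [RHS](integral_supported mK muK); last first.
    by apply: emeasurable_funB => //; exact: measurable_cst.
  apply: eq_integral => w; rewrite inE => Kw.
  rewrite -integral_cst_sub//; last by move=> z; exact: kernel_log_ge0.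
  rewrite (integral_supported mK muK (ml w)) [RHS](integral_supported mK muK); last first.
    by apply: emeasurable_funB => //; exact: measurable_cst.
  by apply: eq_integral => z; rewrite inE => Kz; apply: logdistE => //; exact: Kb.
rewrite integral_cst_sub// oppeB ?fin_num_adde_defr// addeC//.
Qed.

End Energy.

(** * Transport of measures *)

Section Transport.
Context {R : realType}.
Local Notation N := (@normc R).
Local Notation B := (borelC R).
Implicit Types (K : set (C R)) (b t : R).

Lemma measurable_int_kernel_log b (mu : probability B R) :
  measurable_fun setT (fun w => \int[mu]_z kernel_log b (z, w))%E.
Proof.
apply: (@measurable_fun_fubini_tonelli_G _ _ _ _ _ mu (kernel_log b)).
  exact: measurable_kernel_log.
exact: kernel_log_ge0.
Qed.

Lemma log_energyD K (mu : probability B R) b : closed K ->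
  1 <= b -> (forall z w, K z -> K w -> N (z - w) <= b) -> supported_on K mu ->
  (log_energy mu + (ln b)%:E = \int[mu]_w \int[mu]_z kernel_log b (z, w))%E.
Proof.
by move=> clK b1 Kb muK; rewrite (log_energyE clK b1 Kb muK) subeK.
Qed.

(** The preimage of an open set is the trace on K of an open set, up to the
    complement of K. *)
Lemma measurable_patch K (T : C R -> C R) : closed K ->
  (forall z, K z -> forall e : R, 0 < e -> exists2 d : R, 0 < d &
     forall w, K w -> N (w - z) < d -> N (T w - T z) < e) ->
  measurable_fun setT ((fun z => if z \in K then T z else 0) : B -> B).
Proof.
move=> clK cT; have mK := measurable_closed clK.
apply: (measurability _ (erefl (@measurable _ B))).
move=> _ [U oU <-]; rewrite setTI.
pose V := [set w : C R | exists z (d : R), N (w - z) < d /\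
  forall v, K v -> N (v - z) < d -> U (T v)].
have oV : open V.
  rewrite openE => w [z [d [wz dP]]]; apply/nbhs_normcP.
  exists (d - N (w - z)); first by rewrite subr_gt0.
  move=> v vw; exists z, d; split=> //.
  have := ler_normcD (v - w) (w - z); rewrite addrA subrK.
  by move=> h; apply: le_lt_trans h _; rewrite -ltrBrDr.
have KV z : K z -> V z <-> U (T z).
  move=> Kz; split=> [[y [d [zy dP]]]|UTz]; first exact: dP.
  have [d d0 dP] : exists2 d : R, 0 < d & forall w, N (w - T z) < d -> U w.
    by apply/nbhs_normcP; apply: open_nbhs_nbhs; split.
  have [d' d'0 d'P] := cT z Kz d d0.
  exists z, d'; split; first by rewrite subrr normc0.
  by move=> v Kv vz; apply: dP; exact: d'P.
have mV : measurable (V : set B) by exact: measurable_open.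
have [U0|U0] := pselect (U 0).
  rewrite (_ : _ @^-1` _ = (K `&` V) `|` ~` K).
    by apply: measurableU; [exact: measurableI|exact: measurableC].
  apply/seteqP; split=> z /=; case: ifPn; rewrite ?inE ?notin_setE => Kz.
  - by move=> UT; left; split=> //; exact/(KV _ Kz).
  - by right.
  - by case=> [[_ Vz]|//]; exact/(KV _ Kz).
  - by [].
rewrite (_ : _ @^-1` _ = K `&` V); first exact: measurableI.
apply/seteqP; split=> z /=; case: ifPn; rewrite ?inE ?notin_setE => Kz //.
- by move=> UT; split=> //; exact/(KV _ Kz).
- by case=> _ Vz; exact/(KV _ Kz).
- by case.
Qed.

(** The measure nu is the image of mu under T.  The lower bound on the distances
    of image points bounds the energy of nu; the upper bound makes T continuous,
    hence measurable. *)
Lemma energy_transport K K' (T : C R -> C R) b t (mu : probability B R) :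
  closed K -> closed K' -> (forall z, K z -> K' (T z)) -> 1 <= b -> 0 < t ->
  (forall z w, K z -> K w -> N (z - w) <= b) ->
  (forall z w, K' z -> K' w -> N (z - w) <= b) ->
  (forall z w, K z -> K w -> z != w -> [/\ T z != T w,
     ln (b / N (T z - T w)) <= t * ln (b / N (z - w)) &
     ln (b / N (z - w)) <= t * ln (b / N (T z - T w))]) ->
  supported_on K mu -> exists2 nu : probability B R, supported_on K' nu &
    (log_energy nu + (ln b)%:E <= t%:E * (log_energy mu + (ln b)%:E))%E.
Proof.
move=> clK clK' TK b1 t0 Kb K'b dist muK.
have b0 : 0 < b by exact: lt_le_trans b1.
have mK := measurable_closed clK.
have cT z : K z -> forall e : R, 0 < e -> exists2 d : R, 0 < d &
     forall w, K w -> N (w - z) < d -> N (T w - T z) < e.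
  move=> Kz e e0; exists (b * expR (- (t * ln (b / e)))).
    by rewrite mulr_gt0// expR_gt0.
  move=> w Kw; have [->|wz] := eqVneq w z; first by rewrite !subrr normc0.
  have [Twz _ h] := dist w z Kw Kz wz.
  have D0 : 0 < N (w - z) by rewrite normc_gt0 subr_eq0.
  have D1 : 0 < N (T w - T z) by rewrite normc_gt0 subr_eq0.
  rewrite expRN ltr_pdivlMr ?expR_gt0// => H.
  have : t * ln (b / e) < ln (b / N (w - z)).
    rewrite -[X in X < _]expRK ltr_ln ?posrE ?expR_gt0 ?divr_gt0//.
    by rewrite ltr_pdivlMr// mulrC.
  move=> /lt_le_trans /(_ h); rewrite ltr_pM2l// ltr_ln ?posrE ?divr_gt0//.
  by rewrite ltr_pM2l// ltf_pV2 ?posrE.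
have mT := measurable_patch clK cT.
set S : B -> B := (fun z => _) in mT.
have SK z : K z -> S z = T z by move=> Kz; rewrite /S mem_set.
pose X : {mfun B >-> B} := mfun_Sub (mem_set mT).
pose nu : probability B R := distribution mu X.
have nuK' : supported_on K' nu.
  apply/eqP; rewrite eq_le measure_ge0 andbT -[leRHS]muK.
  have mK' := measurable_closed clK'.
  rewrite (_ : nu (~` K') = mu (X @^-1` (~` K')))//.
  apply: le_measure; rewrite ?inE.
  - by rewrite -[X in measurable X]setTI; apply: (mT) => //; exact: measurableC.
  - exact: measurableC.
  - by move=> z K'z Kz; apply: K'z; change (K' (S z)); rewrite SK//; exact: TK.
exists nu => //; rewrite (log_energyD clK' b1 K'b nuK') (log_energyD clK b1 Kb muK).
have mSS : measurable_fun setT (fun p : B * B => kernel_log b (S p.1, S p.2)).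
  apply: (measurableT_comp (measurable_kernel_log b)).
  by apply: measurable_fun_pair; [exact: (measurableT_comp mT measurable_fst)|
    exact: (measurableT_comp mT measurable_snd)].
have mS w : measurable_fun setT (fun z => kernel_log b (S z, S w)).
  exact: measurable_fun_pair1 mSS.
have mk w : measurable_fun setT (fun z => kernel_log b (z, w)).
  exact: measurable_fun_pair1 (measurable_kernel_log b).
have mGS : measurable_fun setT (fun w => \int[mu]_z kernel_log b (S z, S w))%E.
  apply: (@measurable_fun_fubini_tonelli_G _ _ _ _ _ mu
    (fun p => kernel_log b (S p.1, S p.2))) => //.
  by move=> p; exact: kernel_log_ge0.
have int0 (m : probability B R) w : (0 <= \int[m]_z kernel_log b (z, w))%E.
  by apply: integral_ge0 => z _; exact: kernel_log_ge0.
have -> : (\int[nu]_w \int[nu]_z kernel_log b (z, w) =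
    \int[mu]_w \int[mu]_z kernel_log b (S z, S w))%E.
  rewrite (@ge0_integral_pushforward _ _ _ _ _ S mT mu setT)//; last first.
    exact: measurable_int_kernel_log.
  rewrite preimage_setT; apply: eq_integral => w _ /=.
  by rewrite (@ge0_integral_pushforward _ _ _ _ _ S mT mu setT)//
    => z _; exact: kernel_log_ge0.
rewrite -ge0_integralZl//; last 2 first.
- exact: measurable_int_kernel_log.
- by rewrite lee_fin ltW.
rewrite (integral_supported mK muK mGS) [leRHS](integral_supported mK muK); last first.
  by apply: measurable_funeM; exact: measurable_int_kernel_log.
apply: ge0_le_integral => //.
- by move=> w _; apply: integral_ge0 => z _; exact: kernel_log_ge0.
- exact: measurable_funTS.
- by apply: measurable_funTS; apply: measurable_funeM; exact: measurable_int_kernel_log.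
move=> w Kw; rewrite -ge0_integralZl//; last first.
- by rewrite lee_fin ltW.
- by move=> z _; exact: kernel_log_ge0.
rewrite (integral_supported mK muK (mS w)) [leRHS](integral_supported mK muK); last first.
  by apply: measurable_funeM; exact: mk.
apply: ge0_le_integral => //.
- by move=> z _; exact: kernel_log_ge0.
- exact: measurable_funTS.
- by apply: measurable_funTS; apply: measurable_funeM; exact: mk.
move=> z Kz; rewrite !SK//; have [->|zw] := eqVneq z w.
  by rewrite !kernel_log_diag gt0_muley ?lte_fin.
have [Tzw h _] := dist z w Kz Kw zw.
have [-> _] := kernel_logE b0 zw (Kb _ _ Kz Kw).
have [-> _] := kernel_logE b0 Tzw (K'b _ _ (TK _ Kz) (TK _ Kw)).
by rewrite -EFinM lee_fin.
Qed.

End Transport.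

(** * Comparison of capacities *)

Section Capacity.
Context {R : realType}.
Local Notation N := (@normc R).
Implicit Types (E K : set (C R)) (b t : R).

Definition min_energy K : \bar R :=
  ereal_inf [set log_energy mu | mu in [set mu | supported_on K mu]].

Lemma min_energy_ge0 K b : closed K -> 1 <= b ->
  (forall z w, K z -> K w -> N (z - w) <= b) ->
  (0 <= min_energy K + (ln b)%:E)%E.
Proof.
move=> clK b1 Kb; rewrite -leeBlDr// sub0e.
apply: le_ereal_inf_tmp => _ [mu muK <-].
rewrite (log_energyE clK b1 Kb muK) -[leLHS]add0e leeD2r//.
by do 2!(apply: integral_ge0 => ? _); exact: kernel_log_ge0.
Qed.

Lemma min_energy_transport K K' (T : C R -> C R) b t :
  closed K -> closed K' -> (forall z, K z -> K' (T z)) -> 1 <= b -> 0 < t ->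
  (forall z w, K z -> K w -> N (z - w) <= b) ->
  (forall z w, K' z -> K' w -> N (z - w) <= b) ->
  (forall z w, K z -> K w -> z != w -> [/\ T z != T w,
     ln (b / N (T z - T w)) <= t * ln (b / N (z - w)) &
     ln (b / N (z - w)) <= t * ln (b / N (T z - T w))]) ->
  (min_energy K' + (ln b)%:E <= t%:E * (min_energy K + (ln b)%:E))%E.
Proof.
move=> clK clK' TK b1 t0 Kb K'b dist.
rewrite muleC -lee_pdivrMr// -leeBlDr//.
apply: le_ereal_inf_tmp => _ [mu muK <-].
have [nu nuK' h] := energy_transport clK clK' TK b1 t0 Kb K'b dist muK.
rewrite leeBlDr// lee_pdivrMr// muleC; apply: le_trans h.
by rewrite leeD2r//; apply: ereal_inf_lbound; exists nu.
Qed.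

Lemma expR_dist (x y : R) : 0 <= x -> 0 <= y ->
  `|expR (- x) - expR (- y)| <= `|x - y|.
Proof.
wlog xy : x y / x <= y => [H x0 y0|x0 y0].
  have [xy|/ltW yx] := leP x y; first exact: H.
  by rewrite distrC (distrC x); exact: H.
have e0 : expR (- y) <= expR (- x) by rewrite ler_expR lerN2.
rewrite ger0_norm ?subr_ge0// distrC ger0_norm ?subr_ge0//.
have -> : expR (- y) = expR (- x) * expR (- (y - x)).
  by rewrite -expRD; congr expR; ring.
have e1 : 1 - (y - x) <= expR (- (y - x)) by have := expR_ge1Dx (- (y - x)).
have e2 : expR (- x) <= 1 by rewrite -expR0 ler_expR oppr_le0.
have e3 : 0 <= expR (- x) by exact: expR_ge0.
have e4 : expR (- x) * (1 - (y - x)) <= expR (- x) * expR (- (y - x)).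
  by rewrite ler_wpM2l.
have e5 : expR (- x) * (y - x) <= 1 * (y - x) by rewrite ler_wpM2r// subr_ge0.
lra.
Qed.

(** The capacity is b exp (- x) with x = [min_energy] + ln b.  The factor t
    forces the values x for K and K' to be both infinite or both finite, and in
    the latter case to differ by at most (t - 1) max x. *)
Lemma capacity_dist K K' b t : 1 <= b -> 1 <= t ->
  (0 <= min_energy K + (ln b)%:E)%E ->
  (min_energy K' + (ln b)%:E <= t%:E * (min_energy K + (ln b)%:E))%E ->
  (min_energy K + (ln b)%:E <= t%:E * (min_energy K' + (ln b)%:E))%E ->
  `|capacity K - capacity K'| <=
    b * ((t - 1) * (t * fine (min_energy K + (ln b)%:E))).
Proof.
move=> b1 t1; rewrite /capacity -/(min_energy K) -/(min_energy K').
have b0 : 0 < b by exact: lt_le_trans b1.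
have t0 : 0 < t by exact: lt_le_trans t1.
case: (min_energy K) => [x| |]; case: (min_energy K') => [y| |] //=.
- rewrite -!EFinD -!EFinM !lee_fin => x0 yx xy.
  set u := x + ln b in x0 yx xy *; set v := y + ln b in yx xy *.
  have -> : expR (- x) = b * expR (- u).
    by rewrite -[b in b * _]lnK ?posrE// -expRD /u; congr expR; ring.
  have -> : expR (- y) = b * expR (- v).
    by rewrite -[b in b * _]lnK ?posrE// -expRD /v; congr expR; ring.
  rewrite -mulrBr normrM gtr0_norm// ler_pM2l//.
  have v0 : 0 <= v by rewrite -(pmulr_rge0 v t0) (le_trans x0).
  apply: le_trans (expR_dist x0 v0) _.
  have h1 : (t - 1) * u <= (t - 1) * (t * u).
    by rewrite ler_wpM2l ?subr_ge0// ler_peMl.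
  have h2 : (t - 1) * v <= (t - 1) * (t * u) by rewrite ler_wpM2l ?subr_ge0.
  by rewrite ler_norml; apply/andP; split; lra.
- by move=> _ _; rewrite gt0_muleNy ?lte_fin// leeNy_eq.
- by rewrite subrr normr0 !mulr0.
- by rewrite subrr normr0 !mulr0.
Qed.

End Capacity.

(** * Capacity along a holomorphic motion *)

Section CapacityOfMotion.
Context {R : realType}.
Local Notation N := (@normc R).
Implicit Types (E : set (C R)) (f : C R -> C R -> C R) (l : C R) (b d M : R).

Lemma compact_normc_bounded E : compact E -> exists M : R, forall z, E z -> N z <= M.
Proof.
move=> cE; have [E0|] := pselect (E !=set0); last first.
  by move=> E0; exists 0 => z Ez; exfalso; apply: E0; exists z.
have [|c cE' cP] := @compact_EVT_max _ R (fun z : C R => N z) E E0 cE.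
  apply: continuous_in_subspaceT => z _.
  by have := @continuous_normc_comp R id z; apply; exact: cvg_id.
by exists (N c) => z Ez; apply: cP; rewrite inE.
Qed.

(** Once the orbits are bounded, Harnack's inequality can be used about any time
    l0, which makes the factor (d + s) / (d - s), for s = |l - l0|, tend to 1 as
    l tends to l0. *)
Lemma motion_distortion f l0 M : plane_motion f -> N l0 < 1 ->
  exists d b : R, [/\ 0 < d, 1 <= b & forall l, N (l - l0) < d ->
    [/\ N l < 1,
      forall z w, N z <= M -> N w <= M -> N (f z l - f w l) <= b &
      forall z w, N z <= M -> N w <= M -> z != w ->
       let U := ln (b / N (f z l - f w l)) in
       let U0 := ln (b / N (f z l0 - f w l0)) in
       (d - N (l - l0)) * U <= (d + N (l - l0)) * U0 /\
       (d - N (l - l0)) * U0 <= (d + N (l - l0)) * U]].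
Proof.
move=> fm l01; have [df inj f0] := fm.
pose r := (1 + N l0) / 2.
have l00 := normc_ge0 l0.
have r0 : 0 < r by rewrite /r; lra.
have r1 : r < 1 by rewrite /r; lra.
have lr : N l0 < r by rewrite /r; lra.
clearbody r.
have [b b0 bP] := motion_bounded M fm r0 r1.
pose b' := Num.max 1 (2 * b).
have b'1 : 1 <= b' by rewrite /b' le_max lexx.
have bb' : 2 * b <= b' by rewrite /b' le_max lexx orbT.
have b'0 : 0 < b' by exact: lt_le_trans b'1.
have d0 : 0 < r - N l0 by rewrite subr_gt0.
exists (r - N l0), b'; split=> //.
have sub l : N (l - l0) < r - N l0 -> N l < r.
  by move=> h; have := ler_normcD (l - l0) l0; rewrite subrK; move: h; lra.
have diam z w l : N z <= M -> N w <= M -> N l < r -> N (f z l - f w l) <= b'.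
  move=> zM wM lr'; rewrite (le_trans _ bb')// (le_trans (ler_normcD _ _))//.
  by rewrite normcN mulrDl mul1r lerD ?bP.
move=> l ll0; have lr' := sub _ ll0; split=> [|z w zM wM|z w zM wM zw].
- exact: lt_trans r1.
- exact: diam.
- have [d1 d2 _] := motion_diff fm (ltW r1) zw (bP z zM) (bP w wM).
  have := @harnack R (fun l => f z l - f w l) l0 _ b' d0 b'0.
  move=> /(_ (fun v h => d1 v (sub v h)) (fun v h => d2 v (sub v h))).
  move=> /(_ (fun v h => diam z w v zM wM (sub v h)) l ll0) /ratio_bound.
  by apply; exact: ltW.
Qed.

Lemma closed_orbit_image E f l : compact E -> plane_motion f -> N l < 1 ->
  closed ((fun z => f z l) @` E).
Proof.
move=> cE fm l1; have [M EM] := compact_normc_bounded cE.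
pose r := (1 + N l) / 2; have l0 := normc_ge0 l.
have r0 : 0 < r by rewrite /r; lra.
have r1 : r < 1 by rewrite /r; lra.
have lr : N l < r by rewrite /r; lra.
have [b b0 bP] := motion_bounded (M + 1) fm r0 r1.
apply: compact_closed; first exact: norm_hausdorff.
apply: continuous_compact => //.
apply: continuous_in_subspaceT => z; rewrite inE => Ez.
apply/continuous_normcP => e e0.
have [d d0 dP] := motion_equicontinuous fm r0 (ltW r1) b0 lr e0.
exists (Num.min d 1); first by rewrite lt_min d0 ltr01.
move=> w; rewrite lt_min => /andP[wd w1]; apply: dP => //; apply: bP.
- have := ler_normcD (w - z) z; rewrite subrK; have := EM z Ez.
  by move: w1; lra.
- by have := EM z Ez; lra.
Qed.

(** For s <= d / 3 the factor t = (d + s) / (d - s) is at most 2, and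
    t - 1 <= 3 s / d; so the capacity changes by at most 6 b x s / d. *)
Lemma capacity_orbit_continuous E f l0 : compact E -> plane_motion f -> N l0 < 1 ->
  {for l0, continuous (fun l => capacity ((fun z => f z l) @` E))}.
Proof.
move=> cE fm l01; have [M EM] := compact_normc_bounded cE.
have [df inj f0] := fm.
have [d [b [d0 b1 dP]]] := motion_distortion M fm l01.
have b0 : 0 < b by exact: lt_le_trans b1.
pose K l := (fun z => f z l) @` E.
have clK l : N l < 1 -> closed (K l) by exact: closed_orbit_image.
have Kb l : N (l - l0) < d -> forall z w, K l z -> K l w -> N (z - w) <= b.
  move=> ll0 _ _ [z Ez <-] [w Ew <-].
  by have [_ h _] := dP l ll0; apply: h; exact: EM.
have l0d : N (l0 - l0) < d by rewrite subrr normc0.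
(* The point of E whose position at time l is x. *)
pose pos l x := xget 0 [set z | E z /\ f z l = x].
have posE l z : N l < 1 -> E z -> pos l (f z l) = z.
  move=> l1 Ez; have [_ h] : E (pos l (f z l)) /\ f (pos l (f z l)) l = f z l.
    by have := @xgetPex _ 0 [set y | E y /\ f y l = f z l]; apply; exists z.
  exact: inj h.
pose x := fine (min_energy (K l0) + (ln b)%:E).
have V0 : (0 <= min_energy (K l0) + (ln b)%:E)%E.
  exact: (min_energy_ge0 (clK _ l01) b1 (Kb _ l0d)).
have x0 : 0 <= x by exact: fine_ge0.
apply/(@cvgrPdist_lt _ _ _ (nbhs l0)) => e e0.
apply/nbhs_normcP; exists (Num.min (d / 3) (e * d / (6 * b * x + 1))).
  rewrite lt_min !divr_gt0//; first by rewrite mulr_gt0.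
  by rewrite ltr_wpDl// mulr_ge0// mulr_ge0// ltW.
move=> l; rewrite lt_min; set s := N (l - l0) => /andP[s3 se].
have s0 : 0 <= s := normc_ge0 _.
have ld : s < d by lra.
have [l1 _ lP] := dP l ld.
have ds : 0 < d - s by rewrite subr_gt0.
pose t := (d + s) / (d - s).
have t1 : 1 <= t by rewrite ler_pdivlMr// mul1r; lra.
have t0 : 0 < t by exact: lt_le_trans t1.
have dist z w : E z -> E w -> z != w ->
    ln (b / N (f z l - f w l)) <= t * ln (b / N (f z l0 - f w l0)) /\
    ln (b / N (f z l0 - f w l0)) <= t * ln (b / N (f z l - f w l)).
  move=> Ez Ew zw; have [h1 h2] := lP z w (EM z Ez) (EM w Ew) zw.
  by rewrite /t ![_ / _ * _]mulrAC !ler_pdivlMr// ![ln _ * (d - s)]mulrC.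
have neq l' z w : N l' < 1 -> f z l' != f w l' -> z != w.
  by move=> _; apply: contra_neq => ->.
have neq' l' z w : N l' < 1 -> z != w -> f z l' != f w l'.
  by move=> l'1; apply: contra_neq => /inj; exact.
apply: (@le_lt_trans _ _ (b * ((t - 1) * (t * x)))).
  apply: capacity_dist => //.
  - apply: (@min_energy_transport _ _ _ (fun y => f (pos l0 y) l)) => //.
    + exact: clK.
    + exact: clK.
    + by move=> _ [z Ez <-]; rewrite posE//; exists z.
    + exact: Kb.
    + exact: Kb.
    + move=> _ _ [z Ez <-] [w Ew <-] /(neq l0 _ _ l01) zw; rewrite !posE//.
      by have [h1 h2] := dist z w Ez Ew zw; split=> //; exact: neq'.
  - apply: (@min_energy_transport _ _ _ (fun y => f (pos l y) l0)) => //.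
    + exact: clK.
    + exact: clK.
    + by move=> _ [z Ez <-]; rewrite posE//; exists z.
    + exact: Kb.
    + exact: Kb.
    + move=> _ _ [z Ez <-] [w Ew <-] /(neq l _ _ l1) zw; rewrite !posE//.
      by have [h1 h2] := dist z w Ez Ew zw; split=> //; exact: neq'.
have t2 : t <= 2 by rewrite ler_pdivrMr//; lra.
have t3 : t - 1 <= 3 * s / d.
  have -> : t - 1 = 2 * s / (d - s) by rewrite /t; field; rewrite gt_eqF.
  rewrite ler_pdivrMr// mulrAC ler_pdivlMr//.
  have : s * (d - 3 * s) >= 0 by rewrite mulr_ge0//; lra.
  lra.
have h1 : (t - 1) * (t * x) <= 3 * s / d * (2 * x).
  apply: ler_pM => //; first by rewrite subr_ge0.
    by rewrite mulr_ge0// ltW.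
  by rewrite ler_wpM2r.
apply: le_lt_trans (ler_wpM2l (ltW b0) h1) _.
have -> : b * (3 * s / d * (2 * x)) = s * (6 * b * x) / d.
  by field; rewrite gt_eqF.
have bx0 : 0 <= 6 * b * x by rewrite mulr_ge0// mulr_ge0// ltW.
rewrite ltr_pdivrMr//; apply: le_lt_trans (_ : s * (6 * b * x) <= s * (6 * b * x + 1)) _.
  by rewrite ler_wpM2l// lerDl.
by rewrite -ltr_pdivlMr// ltr_wpDl.
Qed.

End CapacityOfMotion.

Theorem theorem1p3 (R : realType) (E : set (C R))
    (h : C R -> sphere R -> sphere R)
    (E_compact : compact E)
    (h_motion : holomorphic_motion [set: sphere R] h)
    (h_infty : forall lam : C R, unit_disk lam -> h lam (infty R) = infty R) :
  {within @unit_disk R, continuous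
    (fun lam : C R => capacity (moved_set h E lam) : R)}.
Proof.
have [h_holo h_inj h_0] := h_motion.
pose f z lam := chart_fin (h lam (embed z)).
have diskE (l : C R) : unit_disk l <-> normc l < 1.
  by rewrite /unit_disk /= normE -[1]/(1%:C) ltcR.
have h_fin l z : unit_disk l -> h l (embed z) = embed (f z l).
  move=> l1; rewrite /f; case E1 : (h l (embed z)) => [w|] //.
  have := h_inj l l1 (embed z) (infty R); rewrite !inE => /(_ I I).
  by rewrite E1 h_infty// => /(_ erefl).
have fm : plane_motion f.
  split=> [z l /diskE l1|z w l /diskE l1 fzw|z].
  - have [_ d1 _] := h_holo (embed z) I; apply: d1 => //.
    by rewrite h_fin.
  - have := h_inj l l1 (embed z) (embed w); rewrite !inE !h_fin// fzw.
    by move=> /(_ I I erefl) [].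
  - by rewrite /f h_0.
have movedE l : unit_disk l -> moved_set h E l = (fun z => f z l) @` E.
  move=> l1; apply/seteqP; split=> [w [_ [z Ez <-]]|_ [z Ez <-]].
    by rewrite h_fin// => -[<-]; exists z.
  by exists (embed z); [exists z|exact: h_fin].
apply: continuous_in_subspaceT => l; rewrite inE => l1.
have c1 := capacity_orbit_continuous E_compact fm ((diskE l).1 l1).
apply/(@cvgrPdist_lt _ _ _ (nbhs l)) => e e0.
have c2 := (@cvgrPdist_lt _ _ _ _ (nbhs_filter l) _ _).1 c1 e e0.
have disk_l : \forall m \near l, unit_disk m.
  apply/nbhs_normcP; exists (1 - normc l); first by rewrite subr_gt0; exact/diskE.
  move=> m ml; apply/diskE; have := ler_normcD (m - l) l.
  by rewrite subrK; move: ml; lra.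
near=> m; rewrite !movedE//; last by near: m.
by near: m.
Unshelve. all: by end_near. Qed.
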